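(* Let $\Omega$ be a bounded domain in the complex plane $\mathbb{C}$, $B$ a closed subset of $\mathbb{C}$ and $A\subset\Omega$ a compact subset of a Lipschitz curve. Let $f$ be an analytic function on $\Omega\setminus B$. (1) If, for some $b>0$ and $C>0$, $$|f(z)|\le C\operatorname{dist}(z,A\cup B)^{-b},\qquad z\in\Omega\setminus(A\cup B),$$ then there is a constant $C_1$ such that $|f(z)|\le C_1\operatorname{dist}(z,B)^{-b}$ for all $z\in\Omega\setminus B$. (2) If, for some $a,b,\alpha>0$, $$|f(z)|\le a\Big(\log\frac{1}{\operatorname{dist}(z,A\cup B)}\Big)^{b},\qquad z\in\Omega\setminus(A\cup B),\ \operatorname{dist}(z,A\cup B)<\alpha,$$ then there are constants $\varepsilon,\tau$ with $\varepsilon>\tau>0$ such that $$|f(z)|\le a\Big(\log\frac{\varepsilon}{\operatorname{dist}(z,B)}\Big)^{b},\qquad z\in\Omega\setminus B,\ \operatorname{dist}(z,B)<\tau.$$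
   Context: Identify $\mathbb{C}$ with $\mathbb{R}^2$. A Lipschitz curve is a compact set $\Gamma\subset\mathbb{R}^2$ for which there are constants $L,R>0$ such that for any $a\in\Gamma$ there exist a Lipschitz function $\varphi\colon(-R,R)\to\mathbb{R}$ with Lipschitz constant at most $L$ and a $2\times2$ orthogonal matrix $U_a$ such that $\big((-R,R)\times(-3LR,3LR)\big)\cap U_a(\Gamma-a)$ equals the graph of $\varphi$. *)

(* Defs.v *)
From HB Require Import structures.
From mathcomp Require Import all_boot all_order all_algebra.
From mathcomp Require Import complex.
From mathcomp Require Import all_classical all_reals all_analysis.

Set Implicit Arguments.
Unset Strict Implicit.
Unset Printing Implicit Defensive.

Import Order.TTheory GRing.Theory Num.Theory.
Import numFieldNormedType.Exports.

Local Open Scope classical_set_scope.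
Local Open Scope ring_scope.

(* [R[i]^o] is the complex numbers as a normed module over themselves, so that
   [derivable] below is differentiability in the complex sense; the library
   norm [`|z|] has values in [R[i]], while [cabs] takes its values in [R]. *)
Definition cabs (R : realType) (z : R[i]^o) : R := ComplexField.Normc.normc z.

(* The infimum in [R] is 0 for the empty set: [dist] is meaningful for
   nonempty [S] only. *)
Definition dist (R : realType) (z : R[i]^o) (S : set R[i]^o) : R :=
  inf [set cabs (z - w) | w in S].

(* To be used for open [D], since [derivable] looks at a neighbourhood of z. *)
Definition analytic_on (R : realType) (D : set R[i]^o) (f : R[i]^o -> R[i]^o)
    : Prop :=
  forall z, D z -> derivable f z 1.

Definition is_domain (R : realType) (D : set R[i]^o) : Prop :=
  [/\ D !=set0, open D & connected D].

Definition vec2 (R : realType) (x y : R) : 'cV[R]_2 :=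
  \col_(i < 2) (if i == 0 then x else y).

Definition C_to_R2 (R : realType) (z : R[i]^o) : 'cV[R]_2 :=
  vec2 (complex.Re z) (complex.Im z).

Definition lipschitz_curve (R : realType) (G : set 'cV[R]_2) : Prop :=
  compact G /\
  exists L r : R, [/\ 0 < L, 0 < r &
    forall a, G a -> exists (phi : R -> R) (U : 'M[R]_2),
      [/\ L.-lipschitz_[set` `]- r, r[] phi,
          U *m U^T = 1%:M &
          [set vec2 x y | x in `]- r, r[ & y in `](- (3 * L * r)), (3 * L * r)[]
            `&` [set U *m (u - a) | u in G]
          = [set vec2 x (phi x) | x in `]- r, r[]]].

(* Main.v *)
Require Import Defs.
From HB Require Import structures.
From mathcomp Require Import all_boot all_order all_algebra.
From mathcomp Require Import complex.
From mathcomp Require Import all_classical all_reals all_analysis.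
From mathcomp Require Import ring lra.

Set Implicit Arguments.
Unset Strict Implicit.
Unset Printing Implicit Defensive.

Import Order.TTheory GRing.Theory Num.Theory.
Import numFieldNormedType.Exports.

Local Open Scope classical_set_scope.
Local Open Scope ring_scope.

(* If z is much closer to A than to B, a rectangle of size comparable to
   d = dist(z, B), adapted to the Lipschitz graph near z, avoids B and has z well
   inside. Its boundary crosses the graph only at two points p, q of its vertical
   sides, and on the boundary the distance to A dominates the vertical distance
   to the graph. After rescaling the rectangle to unit size, the maximum
   principle is applied to an auxiliary function:
   - for (1), to f (w - p)^n (w - q)^n with n >= b;
   - for (2), to f^n / G^m with m / n close to b, where G is a finite sum of
     rational functions, |G| <= log (1 / d) + O(1) at z, and on the boundary
     |G| >= log (1 / dist to A and B) except very close to p and q, where f is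
     bounded and G is large. Letting m / n tend to b keeps the constant a.
   The maximum principle itself comes from Goursat's theorem on rectangles: it
   gives |f z0| <= K max |f| with K depending on the rectangle and on z0 only,
   and K is removed by applying this to the powers of f. *)

(** * Real-valued modulus and complex differentiability *)

Section ComplexAbs.
Variable R : realType.
Implicit Types (z w h : R[i]^o) (x y : R).

(** [f] is differentiable across [A] outside [B], so it is finite on the whole rectangle; what is
    missing is a quantitative bound, since the hypothesis says nothing on [A]. On a vertical side |w
    - p| is exactly the vertical gap to the graph, so a factor vanishing at p compensates the
    blow-up, while the horizontal sides keep a fixed distance. In (1) multiplicative constants are
    harmless. In (2) the constant [a] must survive, so only an additive error beside the logarithm
    is allowed, and the comparison function needs leading coefficient exactly one. The natural
    candidate, a constant minus the logarithms of w - p and q - w, needs a complex logarithm and is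
    infinite at p and q. Truncated sums of 1 / (1 + 2^k w) replace it: they are rational, have
    nonnegative real part on the right half-plane, grow like log_2 (1 / |w|) on the imaginary axis,
    and for Re w >= 1/2 are bounded uniformly in the truncation. The truncation may therefore depend
    on [f] without entering the final constants. *)

Lemma cabsE z : `|z| = (cabs z)%:C%C.
Proof. by case: z. Qed.

Lemma cabs_ge0 z : 0 <= cabs z.
Proof. by case: z => x y; exact: sqrtr_ge0. Qed.

Lemma cabs0 : cabs (0 : R[i]^o) = 0.
Proof. exact: ComplexField.Normc.normc0. Qed.

Lemma cabs_eq0 z : (cabs z == 0) = (z == 0).
Proof.
by apply/eqP/eqP => [/ComplexField.Normc.eq0_normc //|->]; exact: cabs0.
Qed.

Lemma cabs_gt0 z : (0 < cabs z) = (z != 0).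
Proof. by rewrite lt_def cabs_ge0 andbT cabs_eq0. Qed.

Lemma cabs1 : cabs (1 : R[i]^o) = 1.
Proof. exact: ComplexField.Normc.normc1. Qed.

Lemma cabsM z w : cabs (z * w) = cabs z * cabs w.
Proof. exact: ComplexField.Normc.normcM. Qed.

Lemma cabsV z : cabs z^-1 = (cabs z)^-1.
Proof. exact: ComplexField.Normc.normcV. Qed.

Lemma cabsX z n : cabs (z ^+ n) = cabs z ^+ n.
Proof.
by elim: n => [|n IH]; [exact: cabs1 | rewrite !exprS cabsM IH].
Qed.

Lemma cabsN z : cabs (- z) = cabs z.
Proof. by case: z => x y; rewrite /cabs /= !sqrrN. Qed.

Lemma cabsD z w : cabs (z + w) <= cabs z + cabs w.
Proof. by rewrite -lecR rmorphD -!cabsE; exact: ler_normD. Qed.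

Lemma cabsB z w : cabs (z - w) <= cabs z + cabs w.
Proof. by rewrite -(cabsN w); exact: cabsD. Qed.

Lemma cabs_distC z w : cabs (z - w) = cabs (w - z).
Proof. by rewrite -cabsN opprB. Qed.

Lemma cabs_real x : cabs (x%:C%C : R[i]^o) = `|x|.
Proof. by rewrite /cabs /= expr0n addr0 sqrtr_sqr. Qed.

Lemma cabs_imag y : cabs ((0 +i* y)%C : R[i]^o) = `|y|.
Proof. by rewrite /cabs /= expr0n add0r sqrtr_sqr. Qed.

Lemma Re_le_cabs z : `|complex.Re z| <= cabs z.
Proof.
case: z => x y; rewrite /cabs /= -sqrtr_sqr ler_sqrt ?addr_ge0 ?sqr_ge0 //.
by rewrite lerDl sqr_ge0.
Qed.

Lemma Im_le_cabs z : `|complex.Im z| <= cabs z.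
Proof.
case: z => x y; rewrite /cabs /= -sqrtr_sqr ler_sqrt ?addr_ge0 ?sqr_ge0 //.
by rewrite lerDr sqr_ge0.
Qed.

Lemma cabs_le_ReIm z : cabs z <= `|complex.Re z| + `|complex.Im z|.
Proof.
have {1}-> : z = (complex.Re z)%:C%C + (0 +i* complex.Im z)%C.
  by case: z => x y; apply/eqP; rewrite eq_complex /= addr0 add0r !eqxx.
by rewrite (le_trans (cabsD _ _))// cabs_real cabs_imag.
Qed.

(** A positive element of [R[i]] has zero imaginary part, so balls with radii in [R[i]] amount to
    balls with real radii. *)
Lemma nbhs_cabsP z (P : set R[i]^o) :
  nbhs z P <-> exists2 d : R, 0 < d & forall w, cabs (w - z) < d -> P w.
Proof.
split=> [/nbhs_normP[e /= e0 He]|[d d0 Hd]].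
- exists (complex.Re e); first by move: e0; rewrite ltcE => /andP[].
  move=> w wz; apply: He; rewrite /ball_ /= cabsE.
  by move: e0; rewrite !ltcE /= => /andP[/eqP -> _]; rewrite eqxx cabs_distC.
- apply/nbhs_ballP; exists d%:C%C => /=; first by rewrite ltcR.
  by move=> w; rewrite -ball_normE /ball_ /= cabsE ltcR cabs_distC => /Hd.
Qed.

End ComplexAbs.
Section Holomorphy.
Variable R : realType.
Implicit Types (z w h : R[i]^o) (x y : R) (f g : R[i]^o -> R[i]^o).

(** Here [l] is the derivative. Multiplying the difference quotient by w - z lets the estimate
    include w = z, where the quotient says nothing. *)
Lemma derivable_cabs f z : derivable f z 1 ->
  exists l : R[i]^o, forall e : R, 0 < e -> exists2 d : R, 0 < d &
    forall w, cabs (w - z) < d ->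
      cabs (f w - f z - l * (w - z)) <= e * cabs (w - z).
Proof.
move=> /cvg_ex[l /cvgrPdist_lt Hl]; exists l => e e0.
have /Hl : 0 < (e%:C%C : R[i]) by rewrite ltcR.
move=> /(@nbhs_cabsP R 0)[d d0 Hd]; exists d => // w wz.
have [->|wNz] := eqVneq w z; first by rewrite !subrr mulr0 subrr cabs0 mulr0.
have wz0 : w - z != 0 by rewrite subr_eq0.
have := Hd (w - z); rewrite subr0 => /(_ wz wz0).
rewrite cabsE ltcR /= => Hlt.
rewrite -ler_pdivrMr ?cabs_gt0 // -cabsV -cabsM.
apply: le_trans (ltW Hlt); rewrite -cabsN le_eqVlt; apply/orP; left.
have -> : (w - z) *: (1 : R[i]^o) + z = w by rewrite [_ *: _]mulr1 subrK.
rewrite mulrBl mulfK // opprB; apply/eqP; congr (cabs (l - _)).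
exact: mulrC.
Qed.

Lemma derivable_cabs_continuous f z : derivable f z 1 ->
  forall e : R, 0 < e -> exists2 d : R, 0 < d &
    forall w, cabs (w - z) < d -> cabs (f w - f z) < e.
Proof.
move=> df e e0; have : {for z, continuous f}.
  by apply: differentiable_continuous; apply/derivable1_diffP.
have e0C : 0 < (e%:C%C : R[i]) by rewrite ltcR.
move=> /cvgrPdist_lt /(_ _ e0C) /(@nbhs_cabsP R z)[d d0 Hd]; exists d => // w.
by move=> /Hd; rewrite cabsE ltcR cabs_distC.
Qed.

Lemma derivable_affine (c b : R[i]^o) z : derivable (fun w => b + c * w) z 1.
Proof.
have H : derivable (cst b + cst c * id : R[i]^o -> R[i]^o) z 1.
  apply: derivableD; first exact: derivable_cst.
  apply: derivableM; [exact: derivable_cst|exact: derivable_id].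
exact: H.
Qed.

Lemma derivable_comp_affine f (c b : R[i]^o) z :
  derivable f (b + c * z) 1 -> derivable (fun w => f (b + c * w)) z 1.
Proof.
move=> /derivable1_diffP df; apply/derivable1_diffP.
apply: (@differentiable_comp _ _ _ _ (fun w : R[i]^o => b + c * w) f).
  exact/derivable1_diffP/derivable_affine.
exact: df.
Qed.

Lemma derivable_fctD f g z : derivable f z 1 ->
  derivable g z 1 -> derivable (fun w => f w + g w : R[i]^o) z 1.
Proof. by move=> df dg; have H := derivableD df dg; exact: H. Qed.

Lemma derivable_fctM f g z : derivable f z 1 ->
  derivable g z 1 -> derivable (fun w => f w * g w : R[i]^o) z 1.
Proof. by move=> df dg; have H := derivableM df dg; exact: H. Qed.

Lemma derivable_fctX f (n : nat) z : derivable f z 1 ->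
  derivable (fun w => f w ^+ n : R[i]^o) z 1.
Proof.
move=> df; elim: n => [|n IH].
  rewrite (_ : (fun w => _) = cst (1 : R[i]^o)); first exact: derivable_cst.
  by apply/funext => w; rewrite expr0.
rewrite (_ : (fun w => _) = (fun w => f w * f w ^+ n : R[i]^o)).
  exact: derivable_fctM.
by apply/funext => w; rewrite exprS.
Qed.

Lemma derivable_fctV f z : f z != 0 -> derivable f z 1 ->
  derivable (fun w => (f w)^-1 : R[i]^o) z 1.
Proof. by move=> f0 df; have H := derivableV f0 df; exact: H. Qed.

Lemma derivable_subc (k : R[i]^o) z :
  derivable (fun w : R[i]^o => w - k : R[i]^o) z 1.
Proof.
apply: (@derivableB _ _ _ id (cst k)); first exact: derivable_id.
exact: derivable_cst.
Qed.

Lemma derivable_inv_sub z0 z : z != z0 ->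
  derivable (fun w : R[i]^o => (w - z0)^-1 : R[i]^o) z 1.
Proof.
move=> zz0; apply: (@derivable_fctV (fun w => w - z0)); last exact: derivable_subc.
by rewrite subr_eq0.
Qed.

End Holomorphy.

(** * Contour integrals over the boundary of a rectangle *)

Section SegmentIntegral.
Variable R : realType.
Local Notation mu := (@lebesgue_measure R).
Implicit Types (g h : R -> R) (a b c M : R).

Definition seg_int g a b : R := \int[mu]_(x in `[a, b]) g x.

(** Two-sided continuity, at the endpoints too. This is more than continuity on the segment, and is
    available because the integrands come from functions differentiable in the complex sense at
    every point of the segment. *)
Definition seg_cont g a b := forall t, a <= t <= b -> {for t, continuous g}.

Lemma seg_cont_integrable g a b : seg_cont g a b ->
  mu.-integrable `[a, b] (EFin \o g).
Proof.
move=> gc; apply: continuous_compact_integrable; first exact: segment_compact.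
apply: continuous_in_subspaceT => t /set_mem /=; rewrite in_itv /=; exact: gc.
Qed.

Lemma seg_int_split g a b c : a <= c -> c <= b -> seg_cont g a b ->
  seg_int g a b = seg_int g a c + seg_int g c b.
Proof.
move=> ac cb gc; rewrite /seg_int.
have gi := seg_cont_integrable gc.
have := @Rintegral_itvB _ g (BLeft a) (BRight b) c gi.
rewrite !bnd_simp ac cb => /(_ isT isT) /eqP; rewrite subr_eq => /eqP ->.
(* The cut produces the half-open interval from [c] to [b]; adding the single point [c] does not
   change the integral. *)
rewrite addrC Rintegral_itv_obnd_cbnd //.
apply: (@integrableS _ _ _ mu `[a, b]) => //.
by apply: subset_itvr; rewrite bnd_simp.
Qed.

Lemma seg_int_cst k a b : a <= b -> seg_int (fun=> k) a b = k * (b - a).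
Proof.
move=> ab; rewrite /seg_int Rintegral_cst //; congr (_ * _).
transitivity (fine (if (a < b)%R then (b - a)%:E else 0%E)).
  by congr fine; have := lebesgue_measure_itv `[a, b]; rewrite /= lte_fin.
by move: ab; rewrite le_eqVlt => /predU1P[->|->]//; rewrite ltxx subrr.
Qed.

Lemma seg_intD g h a b : seg_cont g a b -> seg_cont h a b ->
  seg_int (fun t => g t + h t) a b = seg_int g a b + seg_int h a b.
Proof.
by move=> gc hc; apply: RintegralD => //; exact: seg_cont_integrable.
Qed.

Lemma seg_intB g h a b : seg_cont g a b -> seg_cont h a b ->
  seg_int (fun t => g t - h t) a b = seg_int g a b - seg_int h a b.
Proof.
by move=> gc hc; apply: RintegralB => //; exact: seg_cont_integrable.
Qed.

Lemma seg_intZ k g a b : seg_cont g a b ->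
  seg_int (fun t => k * g t) a b = k * seg_int g a b.
Proof.
by move=> gc; apply: RintegralZl => //; exact: seg_cont_integrable.
Qed.

Lemma eq_seg_int g h a b : (forall t, a <= t <= b -> g t = h t) ->
  seg_int g a b = seg_int h a b.
Proof.
move=> gh; apply: eq_Rintegral => t /set_mem /=; rewrite in_itv /=; exact: gh.
Qed.

Lemma le_seg_int g h a b : seg_cont g a b -> seg_cont h a b ->
  (forall t, a <= t <= b -> g t <= h t) -> seg_int g a b <= seg_int h a b.
Proof.
move=> gc hc gh; apply: le_Rintegral.
- exact: measurable_itv.
- exact: seg_cont_integrable.
- exact: seg_cont_integrable.
- by move=> t /=; rewrite in_itv /=; exact: gh.
Qed.

Lemma seg_cont_cst k a b : seg_cont (fun=> k) a b.
Proof. by move=> t _; exact: cst_continuous. Qed.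

Lemma seg_int_bound g a b M : a <= b -> seg_cont g a b ->
  (forall t, a <= t <= b -> `|g t| <= M) -> `|seg_int g a b| <= M * (b - a).
Proof.
move=> ab gc gM; rewrite ler_norml -mulNr -!seg_int_cst //.
apply/andP; split; apply: le_seg_int => //; try exact: seg_cont_cst;
  by move=> t /gM; rewrite ler_norml => /andP[].
Qed.

Lemma seg_int_le0 (h : R -> R) (a b : R) : a <= b -> seg_cont h a b ->
  (forall t, a <= t <= b -> h t <= 0) -> seg_int h a b <= 0.
Proof.
move=> ab hc h0; have := le_seg_int hc (@seg_cont_cst 0 a b) h0.
by rewrite seg_int_cst // mul0r.
Qed.

Lemma seg_int_ge0 (h : R -> R) (a b : R) : a <= b -> seg_cont h a b ->
  (forall t, a <= t <= b -> 0 <= h t) -> 0 <= seg_int h a b.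
Proof.
move=> ab hc h0; have := le_seg_int (@seg_cont_cst 0 a b) hc h0.
by rewrite seg_int_cst // mul0r.
Qed.

End SegmentIntegral.
Section ComplexSegment.
Variable R : realType.
Implicit Types (g h : R -> R[i]^o) (a b c M : R) (k : R[i]^o).

Definition cseg_int g a b : R[i]^o :=
  (seg_int (fun t => complex.Re (g t)) a b
   +i* seg_int (fun t => complex.Im (g t)) a b)%C.

Definition cseg_cont g a b := forall t, a <= t <= b -> forall e : R, 0 < e ->
  exists2 d : R, 0 < d & forall s, `|s - t| < d -> cabs (g s - g t) < e.

Lemma cseg_cont_Re g a b : cseg_cont g a b ->
  seg_cont (fun t => complex.Re (g t)) a b.
Proof.
move=> gc t /gc Ht; apply/cvgrPdist_lt => e /Ht[d d0 Hd].
apply/nbhs_normP; exists d => // s /=; rewrite distrC => /Hd.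
by apply: le_lt_trans; rewrite distrC -raddfB; exact: Re_le_cabs.
Qed.

Lemma cseg_cont_Im g a b : cseg_cont g a b ->
  seg_cont (fun t => complex.Im (g t)) a b.
Proof.
move=> gc t /gc Ht; apply/cvgrPdist_lt => e /Ht[d d0 Hd].
apply/nbhs_normP; exists d => // s /=; rewrite distrC => /Hd.
by apply: le_lt_trans; rewrite distrC -raddfB; exact: Im_le_cabs.
Qed.

Lemma cseg_cont_cst k a b : cseg_cont (fun=> k) a b.
Proof. by move=> t _ e e0; exists 1 => // s _; rewrite subrr cabs0. Qed.

Lemma cseg_contD g h a b : cseg_cont g a b -> cseg_cont h a b ->
  cseg_cont (fun t => g t + h t) a b.
Proof.
move=> gc hc t tab e e0; have e20 : 0 < e / 2 by rewrite divr_gt0.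
have [d d0 Hd] := gc t tab _ e20; have [d' d'0 Hd'] := hc t tab _ e20.
exists (Num.min d d'); first by rewrite lt_min d0.
move=> s; rewrite lt_min => /andP[/Hd Hs /Hd' Hs'].
rewrite opprD addrACA (le_lt_trans (cabsD _ _)) // (splitr e) ltrD //.
Qed.

Lemma cseg_contZ k g a b : cseg_cont g a b ->
  cseg_cont (fun t => k * g t) a b.
Proof.
move=> gc t tab e e0.
have k0 : 0 < cabs k + 1 by rewrite ltr_wpDl ?cabs_ge0.
have [d d0 Hd] := gc t tab (e / (cabs k + 1)) (divr_gt0 e0 k0).
exists d => // s /Hd; rewrite ltr_pdivlMr // -mulrBr cabsM mulrC.
by apply: le_lt_trans; rewrite ler_wpM2r ?cabs_ge0 // lerDl.
Qed.

Lemma cseg_int_split g a b c : a <= c -> c <= b -> cseg_cont g a b ->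
  cseg_int g a b = cseg_int g a c + cseg_int g c b.
Proof.
move=> ac cb gc; rewrite /cseg_int (seg_int_split ac cb (cseg_cont_Re gc)).
by rewrite (seg_int_split ac cb (cseg_cont_Im gc)).
Qed.

Lemma cseg_int_cst k a b : a <= b ->
  cseg_int (fun=> k) a b = k * (b - a)%:C%C.
Proof.
move=> ab; rewrite /cseg_int !seg_int_cst //.
by case: k => u v; apply/eqP; rewrite eq_complex /=; apply/andP; split;
  apply/eqP; ring.
Qed.

Lemma cseg_intD g h a b : cseg_cont g a b -> cseg_cont h a b ->
  cseg_int (fun t => g t + h t) a b = cseg_int g a b + cseg_int h a b.
Proof.
move=> gc hc.
have [gR hR] := (cseg_cont_Re gc, cseg_cont_Re hc).
have [gI hI] := (cseg_cont_Im gc, cseg_cont_Im hc).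
rewrite /cseg_int -[RHS]/(Complex _ _) -(seg_intD gR hR) -(seg_intD gI hI).
by congr Complex; apply: eq_seg_int => t _; rewrite raddfD.
Qed.

Lemma cseg_intZ k g a b : cseg_cont g a b ->
  cseg_int (fun t => k * g t) a b = k * cseg_int g a b.
Proof.
move=> gc; have [gR gI] := (cseg_cont_Re gc, cseg_cont_Im gc).
case: k => u v; rewrite /cseg_int -[RHS]/(Complex _ _).
have sZ (r : R) (F : R -> R) : seg_cont F a b ->
    seg_cont (fun t => r * F t) a b.
  by move=> Fc t /Fc Ft; apply: cvgM => //; exact: cvg_cst.
rewrite -(seg_intZ u gR) -(seg_intZ v gI) -(seg_intZ u gI) -(seg_intZ v gR).
rewrite -(seg_intB (sZ u _ gR) (sZ v _ gI)) -(seg_intD (sZ u _ gI) (sZ v _ gR)).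
by congr Complex; apply: eq_seg_int => t _; case: (g t).
Qed.

Lemma eq_cseg_int g h a b : (forall t, a <= t <= b -> g t = h t) ->
  cseg_int g a b = cseg_int h a b.
Proof.
by move=> gh; rewrite /cseg_int; congr Complex; apply: eq_seg_int => t /gh ->.
Qed.

(** The factor 2 comes from bounding real and imaginary parts separately. The sharp constant is not
    pursued, since the passage to powers in [maximum_principle] removes every constant. *)
Lemma cseg_int_bound g a b M : a <= b -> cseg_cont g a b ->
  (forall t, a <= t <= b -> cabs (g t) <= M) ->
  cabs (cseg_int g a b) <= 2 * M * (b - a).
Proof.
move=> ab gc gM; apply: (le_trans (cabs_le_ReIm _)) => /=.
rewrite -mulrA mulr2n mulrDl mul1r; apply: lerD;
  apply: seg_int_bound => // [|t /gM]; [exact: cseg_cont_Re| |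
    exact: cseg_cont_Im|]; apply: le_trans;
  [exact: Re_le_cabs | exact: Im_le_cabs].
Qed.

End ComplexSegment.
Section RectangleIntegral.
Variable R : realType.
Implicit Types (f g : R[i]^o -> R[i]^o) (xa xb ya yb c M : R) (k : R[i]^o).

Definition hside f y (x : R) : R[i]^o := f (x +i* y)%C.
Definition vside f x (y : R) : R[i]^o := f (x +i* y)%C.

(** The counterclockwise integral of f dz: bottom minus top with dz = dx, right minus left with dz =
    i dy. *)
Definition rect_int f xa xb ya yb : R[i]^o :=
  cseg_int (hside f ya) xa xb - cseg_int (hside f yb) xa xb
  + 'i%C * (cseg_int (vside f xb) ya yb - cseg_int (vside f xa) ya yb).

Definition rect_cont f xa xb ya yb :=
  [/\ cseg_cont (hside f ya) xa xb, cseg_cont (hside f yb) xa xb,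
      cseg_cont (vside f xa) ya yb & cseg_cont (vside f xb) ya yb].

Lemma rect_int_splitx f xa xb ya yb c : xa <= c -> c <= xb ->
  rect_cont f xa xb ya yb ->
  rect_int f xa xb ya yb = rect_int f xa c ya yb + rect_int f c xb ya yb.
Proof.
move=> xc cx [h0 h1 _ _]; rewrite /rect_int.
by rewrite (cseg_int_split xc cx h0) (cseg_int_split xc cx h1); ring.
Qed.

Lemma rect_int_splity f xa xb ya yb c : ya <= c -> c <= yb ->
  rect_cont f xa xb ya yb ->
  rect_int f xa xb ya yb = rect_int f xa xb ya c + rect_int f xa xb c yb.
Proof.
move=> yc cy [_ _ v0 v1]; rewrite /rect_int.
by rewrite (cseg_int_split yc cy v0) (cseg_int_split yc cy v1); ring.
Qed.

Lemma rect_contD f g xa xb ya yb :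
  rect_cont f xa xb ya yb -> rect_cont g xa xb ya yb ->
  rect_cont (fun z => f z + g z) xa xb ya yb.
Proof. by move=> [? ? ? ?] [? ? ? ?]; split; apply: cseg_contD. Qed.

Lemma rect_contZ k f xa xb ya yb :
  rect_cont f xa xb ya yb -> rect_cont (fun z => k * f z) xa xb ya yb.
Proof. by move=> [? ? ? ?]; split; apply: cseg_contZ. Qed.

Lemma rect_intD f g xa xb ya yb :
  rect_cont f xa xb ya yb -> rect_cont g xa xb ya yb ->
  rect_int (fun z => f z + g z) xa xb ya yb
  = rect_int f xa xb ya yb + rect_int g xa xb ya yb.
Proof.
move=> [f1 f2 f3 f4] [g1 g2 g3 g4]; rewrite /rect_int.
rewrite [cseg_int (hside _ ya) _ _](cseg_intD f1 g1).
rewrite [cseg_int (hside _ yb) _ _](cseg_intD f2 g2).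
rewrite [cseg_int (vside _ xa) _ _](cseg_intD f3 g3).
by rewrite [cseg_int (vside _ xb) _ _](cseg_intD f4 g4); ring.
Qed.

Lemma rect_intZ k f xa xb ya yb : rect_cont f xa xb ya yb ->
  rect_int (fun z => k * f z) xa xb ya yb = k * rect_int f xa xb ya yb.
Proof.
move=> [f1 f2 f3 f4]; rewrite /rect_int.
rewrite [cseg_int (hside _ ya) _ _](cseg_intZ k f1).
rewrite [cseg_int (hside _ yb) _ _](cseg_intZ k f2).
rewrite [cseg_int (vside _ xa) _ _](cseg_intZ k f3).
by rewrite [cseg_int (vside _ xb) _ _](cseg_intZ k f4); ring.
Qed.

Definition on_rect_boundary xa xb ya yb (z : R[i]^o) : bool :=
  [&& xa <= complex.Re z <= xb, ya <= complex.Im z <= yb &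
   [|| complex.Re z == xa, complex.Re z == xb, complex.Im z == ya
     | complex.Im z == yb]].

Lemma rect_int_bound f xa xb ya yb M : xa <= xb -> ya <= yb ->
  rect_cont f xa xb ya yb ->
  (forall z, on_rect_boundary xa xb ya yb z -> cabs (f z) <= M) ->
  cabs (rect_int f xa xb ya yb) <= 4 * M * ((xb - xa) + (yb - ya)).
Proof.
move=> xab yab [f1 f2 f3 f4] fM.
have B0 : cabs (cseg_int (hside f ya) xa xb) <= 2 * M * (xb - xa).
  apply: cseg_int_bound => // t t01; apply: fM.
  by rewrite /on_rect_boundary /= t01 !lexx ?xab ?yab !eqxx ?orbT.
have B1 : cabs (cseg_int (hside f yb) xa xb) <= 2 * M * (xb - xa).
  apply: cseg_int_bound => // t t01; apply: fM.
  by rewrite /on_rect_boundary /= t01 !lexx ?xab ?yab !eqxx ?orbT.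
have B2 : cabs (cseg_int (vside f xa) ya yb) <= 2 * M * (yb - ya).
  apply: cseg_int_bound => // t t01; apply: fM.
  by rewrite /on_rect_boundary /= t01 !lexx ?xab ?yab !eqxx ?orbT.
have B3 : cabs (cseg_int (vside f xb) ya yb) <= 2 * M * (yb - ya).
  apply: cseg_int_bound => // t t01; apply: fM.
  by rewrite /on_rect_boundary /= t01 !lexx ?xab ?yab !eqxx ?orbT.
rewrite /rect_int; apply: (le_trans (cabsD _ _)).
rewrite cabsM (_ : cabs 'i%C = 1) ?mul1r; last by rewrite cabs_imag normr1.
have A1 := cabsB (cseg_int (hside f ya) xa xb) (cseg_int (hside f yb) xa xb).
have A2 := cabsB (cseg_int (vside f xb) ya yb) (cseg_int (vside f xa) ya yb).
by lra.
Qed.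

Lemma rect_int_cst k xa xb ya yb : rect_int (fun=> k) xa xb ya yb = 0.
Proof. by rewrite /rect_int !subrr mulr0 addr0. Qed.

Lemma cseg_cont_hside_id y xa xb : cseg_cont (hside id y) xa xb.
Proof.
move=> t _ e e0; exists e => // s; rewrite /hside.
rewrite (_ : _ - _ = (s - t)%:C%C) ?cabs_real //.
by apply/eqP; rewrite eq_complex /= subrr !eqxx.
Qed.

Lemma cseg_cont_vside_id x ya yb : cseg_cont (vside id x) ya yb.
Proof.
move=> t _ e e0; exists e => // s; rewrite /vside.
rewrite (_ : _ - _ = (0 +i* (s - t))%C) ?cabs_imag //.
by apply/eqP; rewrite eq_complex /= subrr !eqxx.
Qed.

Lemma rect_cont_id xa xb ya yb : rect_cont id xa xb ya yb.
Proof.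
by split; [exact: cseg_cont_hside_id|exact: cseg_cont_hside_id|
           exact: cseg_cont_vside_id|exact: cseg_cont_vside_id].
Qed.

Lemma rect_cont_cst k xa xb ya yb : rect_cont (fun=> k) xa xb ya yb.
Proof. by split; exact: cseg_cont_cst. Qed.

(* The two horizontal integrands differ by the constant [i (ya - yb)], the two
   vertical ones by [xb - xa]: no primitive is needed. *)
Lemma rect_int_id xa xb ya yb : xa <= xb -> ya <= yb ->
  rect_int id xa xb ya yb = 0.
Proof.
move=> xab yab; rewrite /rect_int.
have -> : cseg_int (hside id ya) xa xb
    = cseg_int (hside id yb) xa xb + (0 +i* (ya - yb))%C * (xb - xa)%:C%C.
  rewrite -cseg_int_cst // -cseg_intD //;
    [|exact: cseg_cont_hside_id|exact: cseg_cont_cst].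
  apply: eq_cseg_int => t _; rewrite /hside; apply/eqP.
  by rewrite eq_complex /= addr0 addrC subrK !eqxx.
have -> : cseg_int (vside id xb) ya yb
    = cseg_int (vside id xa) ya yb + (xb - xa)%:C%C * (yb - ya)%:C%C.
  rewrite -cseg_int_cst // -cseg_intD //;
    [|exact: cseg_cont_vside_id|exact: cseg_cont_cst].
  apply: eq_cseg_int => t _; rewrite /vside; apply/eqP.
  by rewrite eq_complex /= addr0 addrC subrK !eqxx.
rewrite (_ : forall a b c d : R[i], a + c - a + 'i%C * (b + d - b) = c + 'i%C * d).
  by apply/eqP; rewrite eq_complex /=; apply/andP; split; apply/eqP; ring.
by move=> a b c d; ring.
Qed.

Lemma rect_int_affine k l xa xb ya yb : xa <= xb -> ya <= yb ->
  rect_int (fun z => k + l * z) xa xb ya yb = 0.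
Proof.
move=> xab yab; rewrite rect_intD; [|exact: rect_cont_cst|
  exact/rect_contZ/rect_cont_id].
rewrite rect_int_cst (rect_intZ l (rect_cont_id xa xb ya yb)).
by rewrite rect_int_id // mulr0 add0r.
Qed.

Lemma rect_cont_affine k l xa xb ya yb :
  rect_cont (fun z => k + l * z) xa xb ya yb.
Proof.
by apply: rect_contD; [exact: rect_cont_cst|exact/rect_contZ/rect_cont_id].
Qed.

Lemma derivable_hside f y xa xb :
  (forall x, xa <= x <= xb -> derivable f ((x +i* y)%C : R[i]^o) 1) ->
  cseg_cont (hside f y) xa xb.
Proof.
move=> df t /df /derivable_cabs_continuous Hf e /Hf[d d0 Hd].
exists d => // s st; apply: Hd; rewrite (_ : _ - _ = (s - t)%:C%C) ?cabs_real //.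
by apply/eqP; rewrite eq_complex /= subrr !eqxx.
Qed.

Lemma derivable_vside f x ya yb :
  (forall y, ya <= y <= yb -> derivable f ((x +i* y)%C : R[i]^o) 1) ->
  cseg_cont (vside f x) ya yb.
Proof.
move=> df t /df /derivable_cabs_continuous Hf e /Hf[d d0 Hd].
exists d => // s st; apply: Hd.
rewrite (_ : _ - _ = (0 +i* (s - t))%C) ?cabs_imag //.
by apply/eqP; rewrite eq_complex /= subrr !eqxx.
Qed.

Lemma derivable_rect_cont f xa xb ya yb : xa <= xb -> ya <= yb ->
  (forall z, on_rect_boundary xa xb ya yb z -> derivable f z 1) ->
  rect_cont f xa xb ya yb.
Proof.
move=> xab yab df; split; [apply: derivable_hside|apply: derivable_hside|
  apply: derivable_vside|apply: derivable_vside] => t t01; apply: df;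
  by rewrite /on_rect_boundary /= t01 !lexx ?xab ?yab !eqxx ?orbT.
Qed.

End RectangleIntegral.

(** * Goursat's theorem by bisection *)

Section Bisection.
Variable R : realType.
Implicit Types (a b c d xa xb ya yb : R).

Lemma nested_intervals (a b : nat -> R) : (forall n, a n <= a n.+1) ->
  (forall n, b n.+1 <= b n) -> (forall n, a n <= b n) ->
  exists u, forall n, a n <= u <= b n.
Proof.
move=> ia ib ab.
have ha : {homo a : m n / (m <= n)%N >-> m <= n} by apply/nondecreasing_seqP.
have hb : {homo b : m n / (m <= n)%N >-> n <= m} by apply/nonincreasing_seqP.
have amb m n : a m <= b n.
  apply: (le_trans (ha _ _ (leq_maxl m n))).
  by apply: (le_trans (ab _)); apply: hb; exact: leq_maxr.
have sa : has_sup (range a).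
  by split; [exists (a 0%N), 0%N|exists (b 0%N) => _ [m _ <-]].
exists (sup (range a)) => n; apply/andP; split.
  by apply: ub_le_sup; [case: sa|exists n].
by apply: ge_sup; [exists (a 0%N), 0%N|move=> _ [m _ <-]].
Qed.

(** A gauge condition: the small rectangles have to contain the point, possibly on their boundary,
    and their aspect ratio is arbitrary. *)
Definition rect_local (P : R -> R -> R -> R -> Prop) xa xb ya yb :=
  forall u v, xa <= u <= xb -> ya <= v <= yb -> exists2 r : R, 0 < r &
    forall a b c d, xa <= a -> a <= u <= b -> b <= xb ->
      ya <= c -> c <= v <= d -> d <= yb ->
      b - a < r -> d - c < r -> P a b c d.

(** Cousin's lemma for rectangles. If [P] failed, it would fail on some quarter, again and again;
    the nested failures shrink to a point, where local validity contradicts them. *)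
Lemma rect_bisection (P : R -> R -> R -> R -> Prop) xa xb ya yb :
  xa <= xb -> ya <= yb ->
  (forall a b c d, xa <= a -> a <= b -> b <= xb ->
    ya <= c -> c <= d -> d <= yb ->
    let m := (a + b) / 2 in let n := (c + d) / 2 in
    P a m c n -> P m b c n -> P a m n d -> P m b n d -> P a b c d) ->
  rect_local P xa xb ya yb -> P xa xb ya yb.
Proof.
move=> xab yab quarter loc; apply: contrapT => NP.
(* Rectangles where [P] fails; as a sigma type they feed dependent choice, which yields the nested
   sequence. *)
pose good (q : (R * R) * (R * R)) :=
  [/\ xa <= q.1.1, q.1.1 <= q.1.2, q.1.2 <= xb,
      ya <= q.2.1 & q.2.1 <= q.2.2 /\ q.2.2 <= yb]
  /\ ~ P q.1.1 q.1.2 q.2.1 q.2.2.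
pose sub (q q' : {q | good q}) :=
  [/\ (sval q).1.1 <= (sval q').1.1, (sval q').1.2 <= (sval q).1.2,
      (sval q).2.1 <= (sval q').2.1, (sval q').2.2 <= (sval q).2.2 &
      (sval q').1.2 - (sval q').1.1 = ((sval q).1.2 - (sval q).1.1) / 2 /\
      (sval q').2.2 - (sval q').2.1 = ((sval q).2.2 - (sval q).2.1) / 2].
have step : forall q, {q' | sub q q'}.
  move=> [[[a b] [c d]] [[/= h1 h2 h3 h4 [h5 h6]] NPq]]; apply: cid.
  have := quarter a b c d h1 h2 h3 h4 h5 h6.
  set m := (a + b) / 2; set n := (c + d) / 2 => /= Q.
  have [am mb] : a <= m /\ m <= b by rewrite /m; move: h2; clear; lra.
  have [cn nd] : c <= n /\ n <= d by rewrite /n; move: h5; clear; lra.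
  have [mE mE'] : m - a = (b - a) / 2 /\ b - m = (b - a) / 2.
    by rewrite /m; split; field.
  have [nE nE'] : n - c = (d - c) / 2 /\ d - n = (d - c) / 2.
    by rewrite /n; split; field.
  have refine a' b' c' d' : a <= a' -> a' <= b' -> b' <= b -> c <= c' ->
      c' <= d' -> d' <= d -> b' - a' = (b - a) / 2 -> d' - c' = (d - c) / 2 ->
      ~ P a' b' c' d' -> exists q', forall H, sub (exist _ ((a, b), (c, d)) H) q'.
    move=> k1 k2 k3 k4 k5 k6 k7 k8 NP'.
    have g : good ((a', b'), (c', d')).
      by split => //; split => //=; [exact: le_trans k1|exact: le_trans h3|
        exact: le_trans k4|split => //; exact: le_trans h6].
    by exists (exist _ _ g).
  suff [q' Hq'] : exists q', forall H, sub (exist _ ((a, b), (c, d)) H) q'.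
    by exists q'; exact: Hq'.
  have [P1|N1] := pselect (P a m c n); last exact: (refine a m c n).
  have [P2|N2] := pselect (P m b c n); last exact: (refine m b c n).
  have [P3|N3] := pselect (P a m n d); last exact: (refine a m n d).
  have [P4|N4] := pselect (P m b n d); last exact: (refine m b n d).
  by case: NPq; apply: Q.
have g0 : good ((xa, xb), (ya, yb)) by split => //; split.
have [F [F0 FS]] := dependent_choice step (exist _ _ g0).
have [u Hu] : exists u, forall n,
    (sval (F n)).1.1 <= u <= (sval (F n)).1.2.
  apply: nested_intervals => n; try by case: (FS n).
  by case: (svalP (F n)) => -[].
have [v Hv] : exists v, forall n,
    (sval (F n)).2.1 <= v <= (sval (F n)).2.2.
  apply: nested_intervals => n; try by case: (FS n).
  by case: (svalP (F n)) => -[_ _ _ _ []].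
have size n : (sval (F n)).1.2 - (sval (F n)).1.1 = (xb - xa) / 2 ^+ n /\
              (sval (F n)).2.2 - (sval (F n)).2.1 = (yb - ya) / 2 ^+ n.
  elim: n => [|n [IH1 IH2]]; first by rewrite F0 /= expr0 !divr1.
  have [_ _ _ _ [-> ->]] := FS n; rewrite IH1 IH2 exprSr invfM !mulrA.
  by [].
have := Hu 0%N; rewrite F0 /= => u0; have := Hv 0%N; rewrite F0 /= => v0.
(* The limit point lies in every rectangle of the sequence, and the sides are halved each time, so
   some rectangle is smaller than [r] while [P] fails on it. *)
have [r r0 Hr] := loc u v u0 v0.
pose K := (xb - xa) + (yb - ya).
have K0 : 0 <= K by rewrite /K; lra.
have [n Hn] : exists n : nat, K / 2 ^+ n < r.
  exists (Num.bound (K / r)); rewrite ltr_pdivrMr ?exprn_gt0 //.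
  rewrite mulrC -ltr_pdivrMr //.
  apply: (@lt_trans _ _ (Num.bound (K / r))%:R).
    by rewrite archi_boundP // divr_ge0 // ltW.
  by rewrite -natrX ltr_nat ltn_expl.
case: (svalP (F n)) => -[h1 h2 h3 h4 [h5 h6]]; apply.
have [s1 s2] := size n.
have dx : 0 <= xb - xa by rewrite subr_ge0.
have dy : 0 <= yb - ya by rewrite subr_ge0.
apply: Hr => //; rewrite ?s1 ?s2; apply: le_lt_trans Hn;
  by rewrite ler_pM2r ?invr_gt0 ?exprn_gt0 // ?lerDl ?lerDr.
Qed.

End Bisection.
Section Goursat.
Variable R : realType.
Implicit Types (f : R[i]^o -> R[i]^o) (a b c d xa xb ya yb : R) (z : R[i]^o).

Definition in_rect xa xb ya yb z : bool :=
  (xa <= complex.Re z <= xb) && (ya <= complex.Im z <= yb).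

Lemma in_rect_boundary xa xb ya yb z :
  on_rect_boundary xa xb ya yb z -> in_rect xa xb ya yb z.
Proof. by rewrite /in_rect => /and3P[-> ->]. Qed.

Lemma in_rectS xa xb ya yb a b c d z : xa <= a -> b <= xb -> ya <= c ->
  d <= yb -> in_rect a b c d z -> in_rect xa xb ya yb z.
Proof.
move=> h1 h2 h3 h4 /andP[/andP[h5 h6] /andP[h7 h8]].
by rewrite /in_rect (le_trans h1) ?(le_trans h6) ?(le_trans h3) ?(le_trans h8).
Qed.

Lemma rect_cont_in f xa xb ya yb a b c d : xa <= a -> a <= b -> b <= xb ->
  ya <= c -> c <= d -> d <= yb ->
  (forall z, in_rect xa xb ya yb z -> derivable f z 1) -> rect_cont f a b c d.
Proof.
move=> h1 h2 h3 h4 h5 h6 df; apply: derivable_rect_cont => // z.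
by move=> /in_rect_boundary zin; apply: df; exact: in_rectS zin.
Qed.

Lemma rect_int_quarter f a b c d m n : a <= m -> m <= b -> c <= n -> n <= d ->
  (forall z, in_rect a b c d z -> derivable f z 1) ->
  rect_int f a b c d = rect_int f a m c n + rect_int f m b c n
    + rect_int f a m n d + rect_int f m b n d.
Proof.
move=> am mb cn nd df.
rewrite (rect_int_splity cn nd); last by apply: (rect_cont_in _ _ _ _ _ _ df); lra.
rewrite (rect_int_splitx am mb); last by apply: (rect_cont_in _ _ _ _ _ _ df); lra.
rewrite (rect_int_splitx am mb); last by apply: (rect_cont_in _ _ _ _ _ _ df); lra.
exact: addrA.
Qed.

(** Subtracting the first-order Taylor polynomial at [z] does not change the integral, because
    affine functions integrate to 0. Only the remainder has to be estimated. *)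
Lemma goursat_local f a b c d z (l : R[i]^o) e : a <= b -> c <= d ->
  rect_cont f a b c d ->
  (forall w, on_rect_boundary a b c d w ->
     cabs (f w - f z - l * (w - z)) <= e * ((b - a) + (d - c))) ->
  cabs (rect_int f a b c d) <= 4 * e * ((b - a) + (d - c)) ^+ 2.
Proof.
move=> ab cd fc Hf; set k := - f z + l * z.
have kc : rect_cont (fun w : R[i]^o => k + (- l) * w) a b c d.
  exact: rect_cont_affine.
have := rect_intD fc kc; rewrite rect_int_affine // addr0 => <-.
apply: (le_trans (rect_int_bound ab cd (rect_contD fc kc) (M := e * ((b - a) + (d - c))) _)).
  move=> w /Hf; congr (cabs _ <= _); rewrite /k; ring.
by rewrite -!mulrA expr2.
Qed.

Lemma goursat f xa xb ya yb : xa <= xb -> ya <= yb ->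
  (forall z, in_rect xa xb ya yb z -> derivable f z 1) ->
  rect_int f xa xb ya yb = 0.
Proof.
move=> xab yab df; apply/eqP; rewrite -cabs_eq0 eq_le cabs_ge0 andbT.
pose S := (xb - xa) ^+ 2 + (yb - ya) ^+ 2.
have S0 : 0 <= S by rewrite addr_ge0 // sqr_ge0.
suff H (e : R) : 0 < e -> cabs (rect_int f xa xb ya yb) <= e * S.
  apply/ler_addgt0Pr => e e0; rewrite add0r.
  have S1 : 0 < S + 1 by lra.
  apply: (le_trans (H _ (divr_gt0 e0 S1))).
  by rewrite -mulrA ler_piMr ?(ltW e0) // mulrC ler_pdivrMr //; lra.
move=> e0; rewrite /S.
(* Sum of squared sides rather than area: it is exactly additive when both sides are halved, and it
   controls the squared half-perimeter whatever the aspect ratio. *)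
apply: (@rect_bisection _
  (fun a b c d => cabs (rect_int f a b c d) <= e * ((b - a) ^+ 2 + (d - c) ^+ 2))) => //.
- move=> a b c d h1 h2 h3 h4 h5 h6 m n P1 P2 P3 P4.
  have hm : a <= m <= b by move: h2; rewrite /m; clear; lra.
  have hn : c <= n <= d by move: h5; rewrite /n; clear; lra.
  case/andP: hm => am mb; case/andP: hn => cn nd.
  rewrite (rect_int_quarter am mb cn nd); last first.
    by move=> z zin; apply: df; exact: in_rectS zin.
  have D1 := cabsD (rect_int f a m c n + rect_int f m b c n
    + rect_int f a m n d) (rect_int f m b n d).
  have D2 := cabsD (rect_int f a m c n + rect_int f m b c n)
    (rect_int f a m n d).
  have D3 := cabsD (rect_int f a m c n) (rect_int f m b c n).
  have -> : e * ((b - a) ^+ 2 + (d - c) ^+ 2) =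
    e * ((m - a) ^+ 2 + (n - c) ^+ 2) + e * ((b - m) ^+ 2 + (n - c) ^+ 2)
    + e * ((m - a) ^+ 2 + (d - n) ^+ 2) + e * ((b - m) ^+ 2 + (d - n) ^+ 2).
    by rewrite /m /n; field.
  apply: (le_trans D1); apply: lerD P4; apply: (le_trans D2); apply: lerD P3.
  exact: (le_trans D3 (lerD P1 P2)).
- move=> u v uin vin; pose z := (u +i* v)%C : R[i]^o.
  have zin : in_rect xa xb ya yb z by rewrite /in_rect /= uin.
  have [l Hl] := derivable_cabs (df _ zin).
  (* [goursat_local] costs a factor 4, and (p + q)^2 <= 2 (p^2 + q^2) a factor 2. *)
  have e8 : 0 < e / 8 by lra.
  have [r r0 Hr] := Hl _ e8; exists (r / 2); first by lra.
  move=> a b c d h1 /andP[au ub] h2 h3 /andP[cv vd] h4 s1 s2.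
  have ab : a <= b by lra.
  have cd : c <= d by lra.
  have fc : rect_cont f a b c d by exact: (rect_cont_in h1 ab h2 h3 cd h4 df).
  apply: (le_trans (goursat_local (z := z) (l := l) (e := e / 8) ab cd fc _)).
    move=> w /in_rect_boundary /andP[/andP[w1 w2] /andP[w3 w4]].
    have wz : cabs (w - z) <= (b - a) + (d - c).
      apply: (le_trans (cabs_le_ReIm _)); rewrite !raddfB /=.
      by apply: lerD; rewrite ler_norml; apply/andP; split; lra.
    apply: (le_trans (Hr _ _)); first by lra.
    by rewrite ler_pM2l.
  have : 0 <= e * ((b - a) - (d - c)) ^+ 2 by rewrite mulr_ge0 ?sqr_ge0 // ltW.
  by move=> H; lra.
Qed.

End Goursat.

(** * Removable point, crude Cauchy estimate and maximum principle *)

Section MaximumPrinciple.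
Variable R : realType.
Implicit Types (f g : R[i]^o -> R[i]^o) (xa xb ya yb u v : R) (z w : R[i]^o).

Lemma goursat_sub f xa xb ya yb a b c d z0 : xa <= a -> a <= b -> b <= xb ->
  ya <= c -> c <= d -> d <= yb ->
  (forall z, in_rect xa xb ya yb z -> z != z0 -> derivable f z 1) ->
  ~~ in_rect a b c d z0 -> rect_int f a b c d = 0.
Proof.
move=> h1 h2 h3 h4 h5 h6 df z0N; apply: goursat => // z zin; apply: df.
  exact: in_rectS zin.
by apply: contraNneq z0N => <-.
Qed.

(** Four rectangles around a small square centred at [z0] contribute 0 by Goursat. The square of
    half-side [e] contributes at most 4 B (2 e + 2 e), which tends to 0. *)
Lemma goursat_punctured f xa xb ya yb u v (B r : R) :
  xa < u < xb -> ya < v < yb -> 0 < r ->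
  let z0 := (u +i* v)%C : R[i]^o in
  (forall z, in_rect xa xb ya yb z -> z != z0 -> derivable f z 1) ->
  (forall z, z != z0 -> cabs (z - z0) < r -> cabs (f z) <= B) ->
  rect_int f xa xb ya yb = 0.
Proof.
move=> /andP[xau uxb] /andP[yav vyb] r0 z0 df fB.
have B0 : 0 <= B.
  apply: le_trans (cabs_ge0 (f (z0 + (r / 2)%:C%C))) (fB _ _ _).
    rewrite -subr_eq0 addrAC subrr add0r -cabs_eq0 cabs_real.
    by rewrite normr_eq0 gt_eqF // divr_gt0.
  by rewrite addrAC subrr add0r cabs_real gtr0_norm; lra.
(* For [e < m] the square stays inside the rectangle, and its boundary lies within 2 e < r of [z0],
   where [f] is bounded by [B]. *)
pose m := Num.min (Num.min (u - xa) (xb - u)) (Num.min (Num.min (v - ya) (yb - v)) (r / 2)).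
have m0 : 0 < m by rewrite /m !lt_min !subr_gt0 xau uxb yav vyb divr_gt0.
apply/eqP; rewrite -cabs_eq0 eq_le cabs_ge0 andbT.
suff H (e : R) : 0 < e -> e < m -> cabs (rect_int f xa xb ya yb) <= 16 * B * e.
  apply/ler_addgt0Pr => e e0; rewrite add0r.
  have B1 : 0 < 16 * B + 1 by clear -B0; lra.
  pose e' := Num.min (m / 2) (e / (16 * B + 1)).
  have e'0 : 0 < e' by rewrite /e' lt_min !divr_gt0.
  have e'm : e' < m by rewrite /e' gt_min; apply/orP; left; lra.
  apply: (le_trans (H _ e'0 e'm)).
  apply: (@le_trans _ _ ((16 * B + 1) * e')).
    by rewrite ler_pM2r // lerDl.
  by rewrite mulrC -ler_pdivlMr // /e' ge_min lexx orbT.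
move=> e0; rewrite /m !lt_min => /andP[/andP[e1 e2] /andP[/andP[e3 e4] e5]].
clear m m0 B0.
(* No line carrying a side passes through [z0]: each coordinate of [z0] is strictly inside or
   strictly outside the range of the sides. *)
have bdN a b c d z : (a < u < b) || (b < u) || (u < a) ->
    (c < v < d) || (d < v) || (v < c) -> on_rect_boundary a b c d z -> z != z0.
  move=> hab hcd /and3P[hR hI hb]; apply: contraTneq hb => zE.
  by move: hR hI; rewrite zE /= !negb_or => hR hI; lra.
have fc a b c d : xa <= a -> a <= b -> b <= xb -> ya <= c -> c <= d -> d <= yb ->
    (a < u < b) || (b < u) || (u < a) ->
    (c < v < d) || (d < v) || (v < c) -> rect_cont f a b c d.
  move=> h1 h2 h3 h4 h5 h6 h7 h8; apply: derivable_rect_cont => // z zb.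
  by apply: df; [exact: (in_rectS h1 h3 h4 h6 (in_rect_boundary zb))|exact: bdN zb].
have Z a b c d : xa <= a -> a <= b -> b <= xb -> ya <= c -> c <= d -> d <= yb ->
    ~~ ((a <= u <= b) && (c <= v <= d)) -> rect_int f a b c d = 0.
  by move=> h1 h2 h3 h4 h5 h6 h7; exact: (goursat_sub h1 h2 h3 h4 h5 h6 df).
have -> : rect_int f xa xb ya yb = rect_int f (u - e) (u + e) (v - e) (v + e).
  have Z1 : rect_int f xa (u - e) ya yb = 0 by apply: Z; lra.
  have Z2 : rect_int f (u + e) xb ya yb = 0 by apply: Z; lra.
  have Z3 : rect_int f (u - e) (u + e) ya (v - e) = 0 by apply: Z; lra.
  have Z4 : rect_int f (u - e) (u + e) (v + e) yb = 0 by apply: Z; lra.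
  rewrite (@rect_int_splitx _ _ _ _ _ _ (u - e)); [|lra|lra|by apply: fc; lra].
  rewrite Z1 add0r.
  rewrite (@rect_int_splitx _ _ _ _ _ _ (u + e)); [|lra|lra|by apply: fc; lra].
  rewrite Z2 addr0.
  rewrite (@rect_int_splity _ _ _ _ _ _ (v - e)); [|lra|lra|by apply: fc; lra].
  rewrite Z3 add0r.
  rewrite (@rect_int_splity _ _ _ _ _ _ (v + e)); [|lra|lra|by apply: fc; lra].
  by rewrite Z4 addr0.
apply: (@le_trans _ _ (4 * B * ((u + e - (u - e)) + (v + e - (v - e))))).
  apply: rect_int_bound; [lra|lra|by apply: fc; lra|].
  move=> z zb; apply: fB; first by apply: bdN zb; lra.
  move: zb => /in_rect_boundary; rewrite /in_rect => /andP[zR zI].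
  apply: (le_lt_trans (cabs_le_ReIm _)); rewrite !raddfB /=.
  have : `|complex.Re z - u| <= e by rewrite ler_norml; lra.
  have : `|complex.Im z - v| <= e by rewrite ler_norml; lra.
  lra.
lra.
Qed.

End MaximumPrinciple.
Section CrudeCauchy.
Variable R : realType.
Implicit Types (f g : R[i]^o -> R[i]^o) (xa xb ya yb u v : R) (z w : R[i]^o).

Lemma boundary_neq xa xb ya yb u v z : xa < u < xb -> ya < v < yb ->
  on_rect_boundary xa xb ya yb z -> z != (u +i* v)%C.
Proof.
move=> hu hv /and3P[hR hI hb]; apply: contraTneq hb => zE.
by move: hR hI; rewrite zE /= !negb_or => hR hI; lra.
Qed.

(** The imaginary part is the variation of the argument along the boundary. All four sides
    contribute with the same sign, so a strictly positive bound on the bottom side is enough. *)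
Lemma rect_int_inv_neq0 xa xb ya yb u v : xa < u < xb -> ya < v < yb ->
  rect_int (fun w : R[i]^o => (w - (u +i* v)%C)^-1 : R[i]^o) xa xb ya yb != 0.
Proof.
move=> hu hv; set z0 : R[i]^o := (u +i* v)%C; set q := (fun w : R[i]^o => _).
have xab : xa <= xb by clear -hu; lra.
have yab : ya <= yb by clear -hv; lra.
have [c1 c2 c3 c4] : rect_cont q xa xb ya yb.
  apply: derivable_rect_cont => // z zb; apply: derivable_inv_sub.
  exact: boundary_neq hu hv zb.
suff : 0 < complex.Im (rect_int q xa xb ya yb).
  by apply: contraTneq => ->; rewrite ltxx.
have ImE (a b c d : R[i]^o) : complex.Im (a - b + 'i%C * (c - d)) =
    complex.Im a - complex.Im b + (complex.Re c - complex.Re d).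
  by case: a b c d => [? ?] [? ?] [? ?] [? ?] /=; ring.
rewrite /rect_int ImE /cseg_int /=.
(* [S] bounds |w - z0|^2 on the bottom side. *)
pose S := (xb - xa) ^+ 2 + (yb - ya) ^+ 2.
have S0 : 0 < S by rewrite /S addr_gt0 // exprn_gt0 //; clear -hu hv; lra.
have den x y : 0 <= (x - u) ^+ 2 + (y - v) ^+ 2 by rewrite addr_ge0 ?sqr_ge0.
have sq (p r : R) : - r <= p <= r -> p ^+ 2 <= r ^+ 2.
  by move=> /andP[? ?]; rewrite -subr_ge0 subr_sqr mulr_ge0 //; lra.
have B : (v - ya) / S * (xb - xa) <=
    seg_int (fun t => complex.Im (hside q ya t)) xa xb.
  rewrite -seg_int_cst //; apply: le_seg_int; [exact: seg_cont_cst|exact: cseg_cont_Im|].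
  move=> t ht; rewrite /hside /q /=.
  have D0 : 0 < (t - u) ^+ 2 + (ya - v) ^+ 2.
    rewrite ltr_wpDl ?sqr_ge0 // exprn_even_gt0 //=; clear -hv; lra.
  rewrite -mulNr opprB ler_pM2l; last by clear -hv; lra.
  by rewrite lef_pV2 //; apply: lerD; apply: sq; clear -hu hv ht; lra.
have T : seg_int (fun t => complex.Im (hside q yb t)) xa xb <= 0.
  apply: seg_int_le0 => //; first exact: cseg_cont_Im.
  move=> t ht; rewrite /hside /q /= -mulNr mulr_le0_ge0 ?invr_ge0 //.
  by clear -hv; lra.
have L : seg_int (fun t => complex.Re (vside q xa t)) ya yb <= 0.
  apply: seg_int_le0 => //; first exact: cseg_cont_Re.
  move=> t ht; rewrite /vside /q /= mulr_le0_ge0 ?invr_ge0 //.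
  by clear -hu; lra.
have Rt : 0 <= seg_int (fun t => complex.Re (vside q xb t)) ya yb.
  apply: seg_int_ge0 => //; first exact: cseg_cont_Re.
  move=> t ht; rewrite /vside /q /= divr_ge0 //.
  by clear -hu; lra.
have P : 0 < (v - ya) / S * (xb - xa).
  by rewrite mulr_gt0 ?divr_gt0 //; [clear -hv|clear -hu]; lra.
by move: B T L Rt P; rewrite /hside /vside /q /=; clear; lra.
Qed.

(* Goursat's theorem is applied to [(f - f z0) / (z - z0)]; the value of the
   integral of [1 / (z - z0)] does not matter, only that it is not zero. *)
Lemma crude_cauchy_bound xa xb ya yb u v : xa < u < xb -> ya < v < yb ->
  exists2 K : R, 0 < K & forall f (M : R),
    (forall z, in_rect xa xb ya yb z -> derivable f z 1) ->
    (forall z, on_rect_boundary xa xb ya yb z -> cabs (f z) <= M) ->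
    cabs (f (u +i* v)%C) <= K * M.
Proof.
move=> hu hv; set z0 : R[i]^o := (u +i* v)%C.
pose q := fun w : R[i]^o => (w - z0)^-1 : R[i]^o.
have xab : xa <= xb by clear -hu; lra.
have yab : ya <= yb by clear -hv; lra.
have J0 := rect_int_inv_neq0 hu hv; set J := rect_int _ _ _ _ _ in J0.
(* A lower bound for the distance from [z0] to the boundary, hence 1 / |w - z0| <= 1 / m there. *)
pose m := Num.min (Num.min (u - xa) (xb - u)) (Num.min (v - ya) (yb - v)).
have m0 : 0 < m.
  by rewrite /m !lt_min !subr_gt0; case/andP: hu => -> ->; case/andP: hv => -> ->.
have J1 : 0 < cabs J by rewrite cabs_gt0.
exists (4 / m * ((xb - xa) + (yb - ya)) / cabs J).
  by rewrite divr_gt0 // mulr_gt0 // ?divr_gt0 //; clear -hu hv; lra.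
move=> f M df fM.
have zin : in_rect xa xb ya yb z0.
  by rewrite /in_rect /=; clear -hu hv; lra.
have qc : rect_cont q xa xb ya yb.
  apply: derivable_rect_cont => // z zb; apply: derivable_inv_sub.
  exact: boundary_neq hu hv zb.
pose g := fun w : R[i]^o => (f w - f z0) * q w : R[i]^o.
have dg z : in_rect xa xb ya yb z -> z != z0 -> derivable g z 1.
  move=> zr zz0.
  have H : derivable ((f - cst (f z0)) * q) z 1.
    apply: derivableM; last exact: derivable_inv_sub.
    by apply: derivableB; [exact: df|exact: derivable_cst].
  exact: H.
have gc : rect_cont g xa xb ya yb.
  apply: derivable_rect_cont => // z zb; apply: dg; first exact: in_rect_boundary.
  exact: boundary_neq hu hv zb.
have g0 : rect_int g xa xb ya yb = 0.
  have [l Hl] := derivable_cabs (df _ zin).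
  (* First-order expansion with tolerance 1: near [z0] the quotient [g] is bounded by 1 + |l|. *)
  have [r r0 Hr] := Hl 1 ltr01.
  apply: (goursat_punctured hu hv (B := 1 + cabs l) r0 dg).
  move=> z zz0 /Hr H; have zz1 : 0 < cabs (z - z0) by rewrite cabs_gt0 subr_eq0.
  rewrite /g cabsM /q cabsV ler_pdivrMr //.
  have -> : f z - f z0 = (f z - f z0 - l * (z - z0)) + l * (z - z0).
    by rewrite subrK.
  by rewrite (le_trans (cabsD _ _)) // cabsM mulrDl lerD.
(* The integrand equals f w / (w - z0), so only the boundary values of [f] enter the next
   estimate. *)
have E : rect_int (fun w => f z0 * q w + g w) xa xb ya yb = f z0 * J.
  by rewrite rect_intD ?g0 ?addr0 ?rect_intZ //; exact: rect_contZ.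
have : cabs (f z0 * J) <= 4 * (M / m) * ((xb - xa) + (yb - ya)).
  rewrite -E; apply: rect_int_bound => //.
    by apply: rect_contD => //; exact: rect_contZ.
  move=> z zb; have -> : f z0 * q z + g z = f z * q z by rewrite /g; ring.
  rewrite cabsM /q cabsV; apply: ler_pM; [exact: cabs_ge0| |exact: fM|].
    by rewrite invr_ge0 cabs_ge0.
  rewrite lef_pV2 ?posrE ?cabs_gt0 ?subr_eq0 //; last exact: boundary_neq hu hv zb.
  have hR := Re_le_cabs (z - z0); have hI := Im_le_cabs (z - z0).
  move: zb hR hI => /and3P[_ _]; rewrite !raddfB /= !ler_norml /m !ge_min.
  move: hu hv; clear => hu hv /or4P[] /eqP -> hR hI;
    rewrite -?orbA; apply/or4P; [constructor 1|constructor 2|constructor 3|constructor 4]; lra.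
rewrite cabsM -ler_pdivlMr // => H; apply: (le_trans H).
rewrite le_eqVlt; apply/orP; left; apply/eqP; field.
by rewrite !gt_eqF.
Qed.

(** By Bernoulli's inequality the powers of a number above 1 are unbounded. This is what removes a
    multiplicative constant after passing to powers. *)
Lemma expr_bounded_le1 (r K : R) : 0 <= r -> (forall n : nat, r ^+ n <= K) ->
  r <= 1.
Proof.
move=> r0 rK; rewrite leNgt; apply/negP => r1.
pose e : R := r - 1; have e0 : 0 < e by rewrite /e subr_gt0.
have bern (n : nat) : 1 + n%:R * e <= r ^+ n.
  elim: n => [|n IH]; first by rewrite mul0r addr0 expr0.
  rewrite exprS (le_trans _ (ler_wpM2l r0 IH)) //.
  have : 0 <= n%:R * e * e by rewrite !mulr_ge0 ?ler0n ?ltW.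
  by rewrite -natr1 /e; clear; lra.
have K0 : 0 <= K by apply: le_trans (rK 0%N); rewrite expr0.
have : K / e < (Num.bound (K / e))%:R.
  by apply: archi_boundP; rewrite divr_ge0 // ltW.
have := le_trans (bern (Num.bound (K / e))) (rK _).
by rewrite ltr_pdivrMr //; clear; lra.
Qed.

Lemma maximum_principle xa xb ya yb f (M : R) z0 :
  (forall z, in_rect xa xb ya yb z -> derivable f z 1) ->
  xa < complex.Re z0 < xb -> ya < complex.Im z0 < yb -> 0 <= M ->
  (forall z, on_rect_boundary xa xb ya yb z -> cabs (f z) <= M) ->
  cabs (f z0) <= M.
Proof.
move=> df hu hv M0 fM; have [K K0 HK] := crude_cauchy_bound hu hv.
have HX n : cabs (f z0) ^+ n <= K * M ^+ n.
  have dX z : in_rect xa xb ya yb z -> derivable (f ^+ n) z 1.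
    by move=> /df; exact: derivableX.
  have := HK (f ^+ n) (M ^+ n) dX; rewrite !fctE cabsX.
  case: z0 {hu hv HK} => u v /=; apply.
  by move=> z /fM zM; rewrite cabsX lerXn2r // nnegrE ?cabs_ge0.
rewrite leNgt; apply/negP => lt.
have F0 : 0 < cabs (f z0) by exact: le_lt_trans lt.
(* The power argument divides by [M]; for M = 0 the crude bound alone gives the result. *)
have [M1|M1] : 0 < M \/ M = 0.
  by move: M0; rewrite le_eqVlt => /predU1P[<-|]; [right|left].
- have : cabs (f z0) / M <= 1.
    apply: (@expr_bounded_le1 _ K); first by rewrite divr_ge0 // cabs_ge0.
    by move=> n; rewrite expr_div_n ler_pdivrMr ?exprn_gt0.
  by rewrite ler_pdivrMr // mul1r leNgt lt.
- by have := HX 1%N; rewrite !expr1 M1 mulr0 leNgt F0.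
Qed.

End CrudeCauchy.

(** * The power estimate on the unit rectangle *)

Section UnitRectangle.
Variable R : realType.
Implicit Types (F : R[i]^o -> R[i]^o) (z : R[i]^o).

Definition graph_gap (phi : R -> R) z : R :=
  `|complex.Im z - phi (complex.Re z)|.

(** Vanishing at 0 gives |phi| <= L on [-1, 1]; this is why a rectangle of half-height 2 L keeps a
    gap of at least L on its horizontal sides. Nothing is asked outside [-1, 1]. *)
Definition unit_graph (L : R) (phi : R -> R) :=
  phi 0 = 0 /\ forall s t, -1 <= s <= 1 -> -1 <= t <= 1 ->
    `|phi s - phi t| <= L * `|s - t|.

Lemma unit_graph_bound L phi t : 0 < L -> unit_graph L phi ->
  -1 <= t <= 1 -> `|phi t| <= L.
Proof.
move=> L0 [phi0 lip] ht; have := lip t 0 ht; rewrite phi0 !subr0 => H.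
apply: le_trans (H _) _; first by lra.
by rewrite ler_piMr ?(ltW L0) // ler_norml.
Qed.

Lemma graph_gap_le L phi z : 0 < L -> unit_graph L phi ->
  in_rect (-1) 1 (- (2 * L)) (2 * L) z -> graph_gap phi z <= 3 * L.
Proof.
move=> L0 G /andP[hR hI]; have := unit_graph_bound L0 G hR.
by rewrite /graph_gap !ler_norml; move: hI; clear; lra.
Qed.

Lemma cabs_endpoint_le L phi z (t : R) : 0 < L -> unit_graph L phi ->
  -1 <= t <= 1 -> in_rect (-1) 1 (- (2 * L)) (2 * L) z ->
  cabs (z - (t +i* phi t)%C) <= 2 + 3 * L.
Proof.
move=> L0 G ht /andP[hR hI]; have := unit_graph_bound L0 G ht => hp.
apply: (le_trans (cabs_le_ReIm _)); rewrite !raddfB /=; apply: lerD.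
  by rewrite ler_norml; move: hR ht; clear; lra.
by move: hp; rewrite !ler_norml; move: hI; clear; lra.
Qed.

(** On a vertical side the difference with the crossing point is purely imaginary, so its modulus is
    exactly the gap. *)
Lemma unit_boundary_cases L phi z : 0 < L -> unit_graph L phi ->
  on_rect_boundary (-1) 1 (- (2 * L)) (2 * L) z ->
  [\/ complex.Re z = -1 /\ z - ((-1) +i* phi (-1))%C
        = (0 +i* (complex.Im z - phi (complex.Re z)))%C,
      complex.Re z = 1 /\ z - (1 +i* phi 1)%C
        = (0 +i* (complex.Im z - phi (complex.Re z)))%C |
      L <= graph_gap phi z].
Proof.
move=> L0 G zb; have /andP[hR hI] := in_rect_boundary zb.
move: zb => /and3P[_ _]; have := unit_graph_bound L0 G hR.
case: z hR hI => x y /= hR hI hp /or4P[] /eqP E.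
- apply: Or31; split => //; rewrite E; apply/eqP.
  by rewrite eq_complex /= subrr !eqxx.
- apply: Or32; split => //; rewrite E; apply/eqP.
  by rewrite eq_complex /= subrr !eqxx.
- apply: Or33; rewrite /graph_gap /= ler0_norm; move: hp;
    rewrite ler_norml E; move: L0; clear; lra.
- apply: Or33; rewrite /graph_gap /= ger0_norm; move: hp;
    rewrite ler_norml E; move: L0; clear; lra.
Qed.

(** On a vertical side one factor of |w - pl| |w - pr| equals the gap and cancels the blow-up of
    [F]; on the horizontal sides the gap is at least L. The constant depends on L and n only. *)
Lemma power_bound (L : R) (n : nat) : 0 < L -> exists2 K : R, 0 < K &
  forall phi F (M : R), unit_graph L phi -> 0 <= M ->
    (forall z, in_rect (-1) 1 (- (2 * L)) (2 * L) z -> derivable F z 1) ->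
    (forall z, in_rect (-1) 1 (- (2 * L)) (2 * L) z -> 0 < graph_gap phi z ->
      cabs (F z) * graph_gap phi z ^+ n.+1 <= M) ->
    forall z, `|complex.Re z| <= 1 / 2 -> `|complex.Im z| <= L ->
      cabs (F z) <= K * M.
Proof.
move=> L0; pose D : R := 2 + 3 * L; have D0 : 0 < D by rewrite /D; lra.
(* [D] bounds both factors on the rectangle; the two summands serve the vertical and the horizontal
   sides respectively. *)
pose B : R := D ^+ n.+1 + (D * D / L) ^+ n.+1.
have D1 : 0 < D ^+ n.+1 by rewrite exprn_gt0.
have D2 : 0 < (D * D / L) ^+ n.+1.
  by rewrite exprn_gt0 // divr_gt0 // mulr_gt0.
have B0 : 0 < B by rewrite addr_gt0.
exists (4 ^+ n.+1 * B); first by rewrite mulr_gt0 ?exprn_gt0.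
move=> phi F M G M0 dF FM z zR zI.
set pl := ((-1) +i* phi (-1))%C : R[i]^o; set pr := (1 +i* phi 1)%C : R[i]^o.
pose P (w : R[i]^o) : R[i]^o := F w * ((w - pl) * (w - pr)) ^+ n.+1.
have dP w : in_rect (-1) 1 (- (2 * L)) (2 * L) w -> derivable P w 1.
  move=> hw; apply: derivable_fctM; first exact: dF.
  by apply: derivable_fctX; apply: derivable_fctM; exact: derivable_subc.
have gap0 w : 0 <= graph_gap phi w by exact: normr_ge0.
have bP w : on_rect_boundary (-1) 1 (- (2 * L)) (2 * L) w ->
    cabs (P w) <= M * B.
  move=> wb; have win := in_rect_boundary wb.
  have MB : 0 <= M * B by rewrite mulr_ge0 // ltW.
  have h1 : cabs (w - pl) <= D by apply: cabs_endpoint_le => //; clear; lra.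
  have h2 : cabs (w - pr) <= D by apply: cabs_endpoint_le => //; clear; lra.
  rewrite /P cabsM cabsX cabsM.
  have side (r : R) : 0 <= r -> r <= D ->
      cabs (F w) * (graph_gap phi w * r) ^+ n.+1 <= M * B.
    (* At the crossing itself nothing is known about [F], but the factor vanishes because the
       exponent [n.+1] is positive. *)
    move=> r0 rD; have := gap0 w; rewrite le_eqVlt => /predU1P[<-|g0].
      by rewrite mul0r expr0n /= mulr0.
    rewrite exprMn mulrA; apply: ler_pM.
    - by rewrite mulr_ge0 ?cabs_ge0 // exprn_ge0 // ltW.
    - by rewrite exprn_ge0.
    - exact: FM.
    - apply: (@le_trans _ _ (D ^+ n.+1)); last by rewrite lerDl ltW.
      by rewrite lerXn2r // nnegrE ltW.
  have gE (p : R[i]^o) : w - p = (0 +i* (complex.Im w - phi (complex.Re w)))%C ->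
      cabs (w - p) = graph_gap phi w by move=> ->; rewrite cabs_imag.
  case: (unit_boundary_cases L0 G wb) => [[_ /gE E]|[_ /gE E]|Lg].
  - by rewrite [cabs (w - pl)]E; apply: side => //; exact: cabs_ge0.
  - rewrite [cabs (w - pr)]E [cabs (w - pl) * _]mulrC; apply: side => //.
    exact: cabs_ge0.
  - have g0 : 0 < graph_gap phi w by exact: lt_le_trans Lg.
    have FwM : cabs (F w) <= M / L ^+ n.+1.
      rewrite ler_pdivlMr ?exprn_gt0 //; apply: le_trans (FM _ win g0).
      by rewrite ler_wpM2l ?cabs_ge0 // lerXn2r // nnegrE ltW.
    apply: (@le_trans _ _ ((M / L ^+ n.+1) * (D * D) ^+ n.+1)).
      apply: ler_pM => //; first exact: cabs_ge0.
        by rewrite exprn_ge0 // mulr_ge0 // cabs_ge0.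
      rewrite lerXn2r // ?nnegrE ?mulr_ge0 ?cabs_ge0 ?(ltW D0) //.
      by apply: ler_pM => //; exact: cabs_ge0.
    rewrite -mulrA ler_wpM2l // /B expr_div_n mulrC.
    by rewrite lerDr ltW.
have zin : `|complex.Re z| <= 1 / 2 /\ `|complex.Im z| <= L by [].
have MB : 0 <= M * B by rewrite mulr_ge0 // ltW.
have : cabs (P z) <= M * B.
  apply: (maximum_principle dP _ _ MB bP).
    by move: zR; rewrite ler_norml; clear; lra.
  by move: zI L0; rewrite ler_norml; clear; lra.
rewrite /P cabsM cabsX cabsM => HP.
(* Both factors are at least 1/2 at [z], whence the factor 4 ^+ n.+1 in the constant. *)
have far (p : R[i]^o) : complex.Re p = 1 \/ complex.Re p = -1 ->
    1 / 2 <= cabs (z - p).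
  move=> Ep; apply: le_trans (Re_le_cabs _); rewrite raddfB /=.
  move: zR; rewrite ler_norml => zR; case: Ep => ->.
    by rewrite ler0_norm; move: zR; clear; lra.
  by rewrite ger0_norm; move: zR; clear; lra.
have f1 : 1 / 2 <= cabs (z - pl) by apply: far; right.
have f2 : 1 / 2 <= cabs (z - pr) by apply: far; left.
have f12 : (1 / 4) ^+ n.+1 <= (cabs (z - pl) * cabs (z - pr)) ^+ n.+1.
  have q0 : 0 <= 1 / 4 :> R by clear; lra.
  rewrite lerXn2r ?nnegrE ?mulr_ge0 ?cabs_ge0 //.
  rewrite (_ : 1 / 4 = (1 / 2) * (1 / 2)); last by field.
  by apply: ler_pM => //; clear; lra.
have : cabs (F z) * (1 / 4) ^+ n.+1 <= M * B.
  by apply: le_trans HP; rewrite ler_wpM2l ?cabs_ge0.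
rewrite expr_div_n expr1n mul1r -ler_pdivlMr ?invr_gt0 ?exprn_gt0 // invrK.
by move/le_trans; apply; rewrite le_eqVlt; apply/orP; left; apply/eqP; ring.
Qed.

End UnitRectangle.

(** * Rational approximation of the logarithm *)

Section DyadicLogarithm.
Variable R : realType.
Implicit Types (t : R) (N : nat) (w : R[i]^o).

(** A smoothed count of the k < N with 2^k t < 1, hence log_2 (1 / t) + O(1) for t between 2^-N and
    1. *)
Definition dyadic_sum N t : R := \sum_(k < N) (1 + (2 ^+ k * t) ^+ 2)^-1.

Lemma dyadic_term_ge0 t : 0 <= (1 + t ^+ 2)^-1.
Proof. by rewrite invr_ge0 addr_ge0 ?sqr_ge0. Qed.

Lemma dyadic_sum_ge0 N t : 0 <= dyadic_sum N t.
Proof. by apply: sumr_ge0 => k _; exact: dyadic_term_ge0. Qed.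

Lemma dyadic_sumS N t :
  dyadic_sum N.+1 t = (1 + t ^+ 2)^-1 + dyadic_sum N (2 * t).
Proof.
rewrite /dyadic_sum big_ord_recl expr0 mul1r; congr (_ + _).
by apply: eq_bigr => k _; rewrite mulrA -exprSr.
Qed.

Lemma ln2_gt0 : 0 < ln 2 :> R.
Proof. by rewrite ln_gt0 // ltr1n. Qed.

(* The term [t^2 / 3] absorbs, in the passage from [t] to [2 t], the defect
   [1 - 1 / (1 + t^2) <= t^2]. *)
Lemma dyadic_sum_ge_aux N t : 2 ^- N <= t -> t <= 2 ->
  - ln t <= ln 2 * (dyadic_sum N t + 4 / 3 - t ^+ 2 / 3).
Proof.
elim: N t => [|N IH] t Nt t2.
  rewrite expr0 invr1 in Nt; apply: (@le_trans _ _ 0).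
    by rewrite oppr_le0 ln_ge0.
  rewrite mulr_ge0 ?(ltW ln2_gt0) // /dyadic_sum big_ord0.
  have : 0 <= (2 - t) * (2 + t) by rewrite mulr_ge0 //; clear -Nt t2; lra.
  by clear; lra.
have t0 : 0 < t by apply: lt_le_trans Nt; rewrite invr_gt0 exprn_gt0.
(* The constant 4/3 keeps 4/3 - t^2/3 nonnegative up to t = 2, which is as far as doubling can carry
   a t below 1. *)
have [t1|t1] := leP 1 t.
  apply: (@le_trans _ _ 0); first by rewrite oppr_le0 ln_ge0.
  rewrite mulr_ge0 ?(ltW ln2_gt0) //.
  have := dyadic_sum_ge0 N.+1 t.
  have : 0 <= (2 - t) * (2 + t) by rewrite mulr_ge0 //; clear -t1 t2; lra.
  by clear; lra.
have Nt' : 2 ^- N <= 2 * t.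
  by move: Nt; rewrite exprSr invfM ler_pdivrMr // mulrC.
have t2' : 2 * t <= 2 by clear -t1; lra.
have := IH (2 * t) Nt' t2'.
rewrite lnM ?posrE // dyadic_sumS => H.
have {}H : - ln t <= ln 2 * (dyadic_sum N (2 * t) + 4 / 3 - (2 * t) ^+ 2 / 3 + 1).
  by rewrite mulrDr mulr1; move: H; clear; lra.
apply: (le_trans H); rewrite ler_pM2l ?ln2_gt0 //.
have : 1 - t ^+ 2 <= (1 + t ^+ 2)^-1.
  have s0 : 0 <= t ^+ 2 by exact: sqr_ge0.
  rewrite -[leRHS]mul1r ler_pdivlMr; last by clear -s0; lra.
  have : 0 <= t ^+ 2 * t ^+ 2 by rewrite mulr_ge0.
  by clear; lra.
by clear; lra.
Qed.

Lemma dyadic_sum_ge_ln N t : 2 ^- N <= t ->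
  - ln t <= ln 2 * (dyadic_sum N t + 4 / 3).
Proof.
move=> Nt; have [t2|t2] := leP t 2.
  apply: (le_trans (dyadic_sum_ge_aux Nt t2)).
  rewrite ler_pM2l ?ln2_gt0 //; have := sqr_ge0 t; clear; lra.
apply: (@le_trans _ _ 0).
  by rewrite oppr_le0 ln_ge0 //; clear -t2; lra.
by rewrite mulr_ge0 ?(ltW ln2_gt0) // addr_ge0 ?dyadic_sum_ge0 // divr_ge0.
Qed.

(** The sum decreases in t, so below 2^-N it is at least its value at 2^-N. This covers the
    immediate neighbourhood of a crossing. *)
Lemma dyadic_sum_ge_nat N t : 0 <= t -> t <= 2 ^- N ->
  N%:R * ln 2 <= ln 2 * (dyadic_sum N t + 4 / 3).
Proof.
move=> t0 tN; have := dyadic_sum_ge_ln (lexx (2 ^- N)).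
rewrite lnV ?posrE ?exprn_gt0 // opprK lnXn // -[_ *+ N]mulr_natl => H; apply: (le_trans H).
rewrite ler_pM2l ?ln2_gt0 // lerD2r; apply: ler_sum => k _.
have p (s : R) : 0 < 1 + s ^+ 2 by rewrite ltr_wpDr ?sqr_ge0.
rewrite lef_pV2 ?posrE ?p // lerD2l lerXn2r ?nnegrE ?mulr_ge0 ?exprn_ge0 //.
by rewrite ler_pM2l // exprn_gt0.
Qed.

End DyadicLogarithm.
Section DyadicComb.
Variable R : realType.
Implicit Types (t : R) (N : nat) (w : R[i]^o).

(* A rational stand-in, up to O(1) and for [2 ^- N <= |w| <= 1], for
   [ln (1 / w) / ln 2] on the right half-plane. *)
Definition dyadic_comb N w : R[i]^o :=
  \sum_(k < N) (1 + (2 ^+ k : R)%:C%C * w)^-1.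

Lemma Re_sum (I : finType) (E : I -> R[i]) :
  complex.Re (\sum_i E i) = \sum_i complex.Re (E i).
Proof. exact: (raddf_sum (@complex.Re R : Rcomplex R -> R)). Qed.

Lemma Re_inv w : complex.Re w^-1 =
  complex.Re w / (complex.Re w ^+ 2 + complex.Im w ^+ 2).
Proof. by case: w. Qed.

Lemma Re_dyadic (s : R) w : complex.Re (1 + s%:C%C * w) = 1 + s * complex.Re w.
Proof. by case: w => x y /=; rewrite mul0r subr0. Qed.

Lemma Im_dyadic (s : R) w : complex.Im (1 + s%:C%C * w) = s * complex.Im w.
Proof. by case: w => x y /=; rewrite mul0r addr0 add0r. Qed.

(** The poles -2^-k lie in the open left half-plane. *)
Lemma dyadic_denominator_neq0 k w : 0 <= complex.Re w ->
  1 + (2 ^+ k : R)%:C%C * w != 0.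
Proof.
move=> w0; apply/negP => /eqP E.
have : complex.Re (1 + (2 ^+ k : R)%:C%C * w) = 0 by rewrite E.
by rewrite Re_dyadic => /eqP; rewrite gt_eqF // ltr_wpDr // mulr_ge0 // exprn_ge0.
Qed.

Lemma Re_dyadic_comb_ge0 N w : 0 <= complex.Re w ->
  0 <= complex.Re (dyadic_comb N w).
Proof.
move=> w0; rewrite /dyadic_comb Re_sum; apply: sumr_ge0 => k _.
rewrite Re_inv divr_ge0 ?addr_ge0 ?sqr_ge0 // Re_dyadic addr_ge0 //.
by rewrite mulr_ge0 // exprn_ge0.
Qed.

Lemma Re_dyadic_comb_imag N t :
  complex.Re (dyadic_comb N (0 +i* t)%C) = dyadic_sum N `|t|.
Proof.
rewrite /dyadic_comb Re_sum; apply: eq_bigr => k _.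
rewrite Re_inv Re_dyadic Im_dyadic /= mulr0 addr0 expr1n mul1r.
by rewrite !exprMn real_normK ?num_real.
Qed.

Lemma cabs_sum_le N (E : 'I_N -> R[i]^o) : cabs (\sum_i E i) <= \sum_i cabs (E i).
Proof.
elim: N E => [|N IH] E; first by rewrite !big_ord0 cabs0.
by rewrite !big_ord_recl (le_trans (cabsD _ _)) // lerD2l.
Qed.

(** Away from 0 the terms decay geometrically. The bound is uniform in [N], which leaves [N] free to
    depend on the function to be estimated. *)
Lemma cabs_dyadic_comb_le N w : 1 / 2 <= complex.Re w ->
  cabs (dyadic_comb N w) <= 4.
Proof.
move=> w0; apply: (le_trans (cabs_sum_le _)).
have H (k : nat) : cabs (1 + (2 ^+ k : R)%:C%C * w)^-1 <= 2 * 2 ^- k.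
  have p0 : 0 < 2 ^+ k :> R by rewrite exprn_gt0.
  have : 2 ^+ k / 2 <= cabs (1 + (2 ^+ k : R)%:C%C * w).
    apply: le_trans (Re_le_cabs _); rewrite Re_dyadic.
    apply: le_trans (ler_norm _).
    have : 2 ^+ k * (1 / 2) <= 2 ^+ k * complex.Re w by rewrite ler_pM2l.
    by clear; lra.
  rewrite cabsV => H; rewrite -[leRHS]invrK lef_pV2 ?posrE ?invr_gt0 //.
  - by rewrite invfM invrK mulrC.
  - by apply: lt_le_trans H; rewrite divr_gt0.
(* The partial sums of the geometric majorant, a form stable under induction. *)
apply: (@le_trans _ _ (4 - 4 * 2 ^- N)).
  elim: N => [|N IH]; first by rewrite big_ord0 expr0 invr1 mulr1 subrr.
  rewrite big_ord_recr /=; apply: (le_trans (lerD IH (H N))).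
  by rewrite exprS invfM; clear; lra.
have : 0 <= 2 ^- N :> R by rewrite invr_ge0 exprn_ge0.
by clear; lra.
Qed.

Lemma derivable_dyadic_comb N (c b : R[i]^o) w : 0 <= complex.Re (b + c * w) ->
  derivable (fun v : R[i]^o => dyadic_comb N (b + c * v)) w 1.
Proof.
move=> w0; elim: N => [|N IH].
  rewrite (_ : (fun v => _) = cst (0 : R[i]^o)); first exact: derivable_cst.
  by apply/funext => v; rewrite /dyadic_comb big_ord0.
pose D (v : R[i]^o) : R[i]^o := 1 + (2 ^+ N : R)%:C%C * (b + c * v).
have dD : derivable D w 1.
  have := @derivable_affine R ((2 ^+ N : R)%:C%C * c) (1 + (2 ^+ N : R)%:C%C * b) w.
  by congr (derivable _ w 1); apply/funext => v; rewrite /D mulrDr mulrA addrA.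
have D0 : D w != 0 by exact: dyadic_denominator_neq0.
have dV := derivableV D0 dD.
have := derivable_fctD IH dV.
congr (derivable _ w 1); apply/funext => v.
by rewrite /dyadic_comb big_ord_recr.
Qed.

End DyadicComb.

(** * The logarithmic estimate on the unit rectangle *)

Section LogBound.
Variable R : realType.
Implicit Types (F : R[i]^o -> R[i]^o) (z : R[i]^o).

Lemma cseg_bounded (g : R -> R[i]^o) (a b : R) : a <= b -> cseg_cont g a b ->
  exists M : R, forall t, a <= t <= b -> cabs (g t) <= M.
Proof.
move=> ab gc; have [|c _ Hc] := @EVT_max R (fun t => cabs (g t)) a b ab.
  apply: continuous_in_subspaceT => t /set_mem /=; rewrite in_itv /= => tab.
  apply/cvgrPdist_lt => e e0; have [d d0 Hd] := gc t tab e e0.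
  apply/nbhs_normP; exists d => // s /=; rewrite distrC => /Hd.
  apply: le_lt_trans; rewrite ler_norml.
  have H1 := cabsD (g t) (g s - g t); have H2 := cabsD (g s) (g t - g s).
  rewrite (cabs_distC (g t) (g s)) in H2.
  rewrite (addrC (g t)) subrK in H1; rewrite (addrC (g s)) subrK in H2.
  by move: H1 H2; clear; lra.
by exists (cabs (g c)) => t tab; apply: Hc; rewrite in_itv.
Qed.

(* Comparing integer powers [f^n] and [G^m], with [m] just above [b n], avoids
   taking complex powers; the loss is absorbed as [n] tends to infinity. *)
Lemma powR_le_of_powers (x a X b : R) : 0 <= x -> 0 < a -> 1 <= X -> 0 < b ->
  (forall n m : nat, b * n%:R <= m%:R -> x ^+ n <= a ^+ n * X ^+ m) ->
  x <= a * X `^ b.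
Proof.
move=> x0 a0 X1 b0 H; have X0 : 0 < X by exact: lt_le_trans X1.
have c0 : 0 < a * X `^ b by rewrite mulr_gt0 ?powR_gt0.
rewrite -[leRHS]mul1r -ler_pdivrMr //.
apply: (@expr_bounded_le1 _ _ X); first by rewrite divr_ge0 // ltW.
move=> n; have bn0 : 0 <= b * n%:R by rewrite mulr_ge0 // ltW.
(* With m the integer just above b n, X^m exceeds (X^b)^n by at most one factor X, independent of
   n. *)
have /andP[t1 t2] := truncn_itv bn0.
have := H n (Num.Def.trunc (b * n%:R)).+1 (ltW t2).
rewrite expr_div_n ler_pdivrMr ?exprn_gt0 // => /le_trans; apply.
rewrite exprMn mulrCA ler_pM2l ?exprn_gt0 // exprS ler_pM2l //.
rewrite -powR_mulrn ?(ltW X0) // -powR_mulrn ?powR_ge0 // -powRrM.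
exact: ler_powR.
Qed.

(** The loss is only the additive [K], which depends on L alone: [F] is compared with a function
    whose real part dominates Lam - ln gap on the boundary and whose modulus at [z] is at most Lam +
    K. *)
Lemma log_bound (L : R) : 0 < L -> exists2 K : R, 0 <= K &
  forall phi F (a b Lam : R), unit_graph L phi -> 0 < a -> 0 < b ->
    1 <= Lam -> 1 + ln (3 * L) <= Lam ->
    (forall z, in_rect (-1) 1 (- (2 * L)) (2 * L) z -> derivable F z 1) ->
    (forall z, in_rect (-1) 1 (- (2 * L)) (2 * L) z -> 0 < graph_gap phi z ->
      cabs (F z) <= a * (Lam - ln (graph_gap phi z)) `^ b) ->
    forall z, `|complex.Re z| <= 1 / 2 -> `|complex.Im z| <= L ->
      cabs (F z) <= a * (Lam + K) `^ b.
Proof.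
(* The first term of [K1] covers the error ln 2 * (4/3) of the dyadic estimates, the second the
   horizontal sides, where -ln gap <= -ln L. The further 8 ln 2 in the constant comes from two
   combs, each at most 4 at [z]. *)
move=> L0; pose K1 : R := ln 2 * (8 / 3) + `|ln L|.
have l2 : 0 < ln 2 :> R by exact: ln2_gt0.
have K10 : 0 <= K1 by rewrite addr_ge0 // mulr_ge0 ?(ltW l2).
exists (K1 + 8 * ln 2); first by rewrite addr_ge0 // mulr_ge0 ?(ltW l2).
move=> phi F a b Lam G a0 b0 Lam1 Lam3 dF FM z zR zI.
set Q := in_rect (-1) 1 (- (2 * L)) (2 * L) in dF FM.
have Lrect : - (2 * L) <= 2 * L by clear -L0; lra.
pose pl := ((-1) +i* phi (-1))%C : R[i]^o; pose pr := (1 +i* phi 1)%C : R[i]^o.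
have [Ml HMl] : exists M : R, forall t, - (2 * L) <= t <= 2 * L ->
    cabs (F ((-1) +i* t)%C) <= M.
  apply: cseg_bounded => //; apply: derivable_vside => t ht.
  by apply: dF; rewrite /Q /in_rect /= ht lexx; clear; lra.
have [Mr HMr] : exists M : R, forall t, - (2 * L) <= t <= 2 * L ->
    cabs (F (1 +i* t)%C) <= M.
  apply: cseg_bounded => //; apply: derivable_vside => t ht.
  by apply: dF; rewrite /Q /in_rect /= ht lexx; clear; lra.
pose M := Num.max Ml Mr.
(* [M] is finite by continuity on the vertical sides but not controlled. [N] makes the comb large
   enough to beat it where the gap is below 2^-N. *)
have [N HN] : exists N : nat, M <= a * (Lam + N%:R * ln 2) `^ b.
  have [M0|M0] := leP M 0.
    by exists 0%N; rewrite (le_trans M0) // mulr_ge0 ?powR_ge0 // ltW.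
  pose X := (M / a) `^ b^-1; have X0 : 0 <= X by exact: powR_ge0.
  exists (Num.bound (X / ln 2)); rewrite mulrC -ler_pdivrMr //.
  have -> : M / a = X `^ b.
    by rewrite -powRrM mulVf ?gt_eqF // powRr1 // divr_ge0 // ltW.
  have : X / ln 2 < (Num.bound (X / ln 2))%:R.
    by apply: archi_boundP; rewrite divr_ge0 // ltW.
  rewrite ltr_pdivrMr // => H.
  apply: ge0_ler_powR; rewrite ?nnegrE ?(ltW b0) //.
    by move: X0 H Lam1; clear; lra.
  by move: H Lam1; clear; lra.
pose l2C : R[i]^o := (ln 2)%:C%C.
(* The arguments are w - pl and pr - w, both in the closed right half-plane on the rectangle. *)
pose cl (w : R[i]^o) := dyadic_comb N (- pl + 1 * w).
pose cr (w : R[i]^o) := dyadic_comb N (pr + (-1) * w).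
pose H (w : R[i]^o) : R[i]^o := (Lam + K1)%:C%C + l2C * (cl w + cr w).
have Rel w : Q w -> 0 <= complex.Re (- pl + 1 * w).
  rewrite /Q /in_rect => /andP[hR _].
  by rewrite mul1r raddfD /= opprK; move: hR; clear; lra.
have Rer w : Q w -> 0 <= complex.Re (pr + (-1) * w).
  rewrite /Q /in_rect => /andP[hR _].
  by rewrite mulN1r raddfB /=; move: hR; clear; lra.
have ReH w : complex.Re (H w) =
    Lam + K1 + ln 2 * (complex.Re (cl w) + complex.Re (cr w)).
  rewrite /H; move: (cl w) (cr w) => [x1 x2] [u1 u2] /=.
  by rewrite mul0r subr0.
have ReH1 w : Q w -> Lam + K1 <= complex.Re (H w).
  move=> Qw; rewrite ReH lerDl mulr_ge0 ?(ltW l2) // addr_ge0 //.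
    exact/Re_dyadic_comb_ge0/Rel.
  exact/Re_dyadic_comb_ge0/Rer.
have LK1 : 1 <= Lam + K1 by move: Lam1 K10; clear; lra.
have HN0 w : Q w -> H w != 0.
  move=> /ReH1 Hw; apply/negP => /eqP E; move: Hw; rewrite E /=.
  by move: LK1; clear; lra.
have dH w : Q w -> derivable H w 1.
  move=> Qw; apply: derivable_fctD; first exact: derivable_cst.
  apply: derivable_fctM; first exact: derivable_cst.
  by apply: derivable_fctD; apply: derivable_dyadic_comb; [exact: Rel|exact: Rer].
have zQ : Q z.
  rewrite /Q /in_rect; move: zR zI L0; rewrite !ler_norml; clear; lra.
have Hz : cabs (H z) <= Lam + (K1 + 8 * ln 2).
  rewrite /H (le_trans (cabsD _ _)) // cabs_real ger0_norm; last first.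
    by move: LK1; clear; lra.
  rewrite cabsM /l2C cabs_real ger0_norm ?(ltW l2) //.
  have Hl : cabs (cl z) <= 4.
    apply: cabs_dyadic_comb_le; rewrite [1 * z]mul1r raddfD /= opprK.
    by move: zR; rewrite ler_norml; clear; lra.
  have Hr : cabs (cr z) <= 4.
    apply: cabs_dyadic_comb_le; rewrite mulN1r raddfB /=.
    by move: zR; rewrite ler_norml; clear; lra.
  have : ln 2 * cabs (cl z + cr z) <= ln 2 * 8.
    rewrite ler_pM2l //; apply: (le_trans (cabsD _ _)).
    by move: Hl Hr; clear; lra.
  by clear; lra.
have bF w : on_rect_boundary (-1) 1 (- (2 * L)) (2 * L) w ->
    cabs (F w) <= a * complex.Re (H w) `^ b.
  move=> wb; have Qw : Q w := in_rect_boundary wb.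
  have mono (X : R) : 0 <= X -> X <= complex.Re (H w) -> cabs (F w) <= a * X `^ b ->
      cabs (F w) <= a * complex.Re (H w) `^ b.
    move=> X0 XH /le_trans; apply; rewrite ler_pM2l //.
    by apply: ge0_ler_powR; rewrite ?nnegrE ?(ltW b0) // (le_trans X0).
  have g0 : 0 <= graph_gap phi w by exact: normr_ge0.
  have gL : graph_gap phi w <= 3 * L by exact: graph_gap_le Qw.
  (* Monotonicity of the real power needs nonnegative bases; this is the purpose of 1 + ln (3 L) <=
     Lam. *)
  have pos : 0 < graph_gap phi w -> 0 <= Lam - ln (graph_gap phi w).
    move=> gp; have : ln (graph_gap phi w) <= ln (3 * L).
      by rewrite ler_ln // posrE mulr_gt0.
    by move: Lam3; clear; lra.
  have side : cabs (F w) <= M ->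
      ln 2 * dyadic_sum N (graph_gap phi w) + (Lam + K1) <= complex.Re (H w) ->
      cabs (F w) <= a * complex.Re (H w) `^ b.
    (* Above 2^-N the hypothesis on [F] is used, below it only the bound [M]. *)
    move=> FwM ReHw; have [gN|gN] := leP (2 ^- N) (graph_gap phi w).
      have gp : 0 < graph_gap phi w.
        by apply: lt_le_trans gN; rewrite invr_gt0 exprn_gt0.
      apply: (mono _ (pos gp) _ (FM _ Qw gp)); apply: le_trans ReHw.
      have := dyadic_sum_ge_ln gN; rewrite /K1.
      by have := normr_ge0 (ln L); move: l2; clear; lra.
    apply: (@mono (Lam + N%:R * ln 2)); last exact: le_trans HN.
      by rewrite addr_ge0 ?mulr_ge0 ?(ltW l2) //; move: Lam1; clear; lra.
    apply: le_trans ReHw.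
    have := dyadic_sum_ge_nat g0 (ltW gN); rewrite /K1.
    by have := normr_ge0 (ln L); move: l2; clear; lra.
  have hI : - (2 * L) <= complex.Im w <= 2 * L by case/andP: Qw.
  case: (unit_boundary_cases L0 G wb) => [[ER E]|[ER E]|Lg].
  - apply: side.
      rewrite /M le_max; apply/orP; left; have := HMl _ hI.
      by rewrite -ER; case: (w).
    rewrite ReH addrC lerD2l ler_pM2l //.
    have -> : cl w = dyadic_comb N (0 +i* (complex.Im w - phi (complex.Re w)))%C.
      by rewrite /cl mul1r addrC E.
    rewrite Re_dyadic_comb_imag lerDl.
    exact/Re_dyadic_comb_ge0/Rer.
  - apply: side.
      rewrite /M le_max; apply/orP; right; have := HMr _ hI.
      by rewrite -ER; case: (w).
    rewrite ReH addrC lerD2l ler_pM2l //.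
    have -> : cr w = dyadic_comb N (0 +i* - (complex.Im w - phi (complex.Re w)))%C.
      rewrite /cr mulN1r -opprB E; congr dyadic_comb.
      by apply/eqP; rewrite eq_complex /= oppr0 !eqxx.
    rewrite Re_dyadic_comb_imag normrN lerDr.
    exact/Re_dyadic_comb_ge0/Rel.
  - have gp : 0 < graph_gap phi w by exact: lt_le_trans Lg.
    apply: (mono _ (pos gp) _ (FM _ Qw gp)).
    apply: le_trans (ReH1 _ Qw); rewrite lerD2l /K1.
    have : ln L <= ln (graph_gap phi w) by rewrite ler_ln.
    have : 0 <= `|ln L| + ln L by rewrite -lerBlDr sub0r ler_normr lexx orbT.
    by move: l2; clear; lra.
apply: powR_le_of_powers => //; first exact: cabs_ge0.
  by move: LK1 l2; clear; lra.
move=> n m bnm.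
have dP w : Q w -> derivable (fun w => F w ^+ n * (H w ^+ m)^-1 : R[i]^o) w 1.
  move=> Qw; apply: derivable_fctM; first exact/derivable_fctX/dF.
  have Hm : H w ^+ m != 0 by rewrite expf_neq0 // HN0.
  by apply: (@derivable_fctV _ (fun w => H w ^+ m)) => //; exact/derivable_fctX/dH.
have bP w : on_rect_boundary (-1) 1 (- (2 * L)) (2 * L) w ->
    cabs (F w ^+ n * (H w ^+ m)^-1) <= a ^+ n.
  move=> wb; have Qw : Q w := in_rect_boundary wb.
  have H1 : 1 <= complex.Re (H w) by apply: le_trans (ReH1 _ Qw).
  have H0 : 0 <= complex.Re (H w) by exact: le_trans H1.
  have Hc : 0 < cabs (H w) by rewrite cabs_gt0 HN0.
  rewrite cabsM cabsV !cabsX ler_pdivrMr ?exprn_gt0 //.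
  apply: (@le_trans _ _ ((a * complex.Re (H w) `^ b) ^+ n)).
    rewrite lerXn2r ?nnegrE ?cabs_ge0 ?mulr_ge0 ?(ltW a0) ?powR_ge0 //.
    exact: bF.
  rewrite exprMn ler_pM2l ?exprn_gt0 //.
  rewrite -[_ ^+ n]powR_mulrn ?powR_ge0 // -powRrM.
  (* Raising the exponent from b n to m is allowed because Re (H w) >= 1. *)
  apply: (@le_trans _ _ (complex.Re (H w) ^+ m)).
    by rewrite -[_ ^+ m]powR_mulrn //; exact: ler_powR.
  rewrite lerXn2r ?nnegrE ?cabs_ge0 //.
  exact: le_trans (ler_norm _) (Re_le_cabs _).
have an0 : 0 <= a ^+ n by rewrite exprn_ge0 // ltW.
have : cabs (F z ^+ n * (H z ^+ m)^-1) <= a ^+ n.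
  apply: (maximum_principle (f := fun w => F w ^+ n * (H w ^+ m)^-1 : R[i]^o)
    dP _ _ an0 bP).
    by move: zR; rewrite ler_norml; clear; lra.
  by move: zI L0; rewrite ler_norml; clear; lra.
have Hc : 0 < cabs (H z) by rewrite cabs_gt0 HN0.
rewrite cabsM cabsV !cabsX ler_pdivrMr ?exprn_gt0 // => /le_trans; apply.
by rewrite ler_wpM2l // lerXn2r // nnegrE ?cabs_ge0 // (le_trans (cabs_ge0 (H z))).
Qed.

End LogBound.

(** * Distances, frames of the curve and rescaling *)

Section DistanceToSet.
Variable R : realType.
Implicit Types (z w : R[i]^o) (S T : set R[i]^o).

Lemma dist_lbound z S : lbound [set cabs (z - w) | w in S] 0.
Proof. by move=> _ [w _ <-]; exact: cabs_ge0. Qed.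

Lemma dist_le z w S : S w -> dist z S <= cabs (z - w).
Proof.
by move=> Sw; apply: ge_inf; [exists 0; exact: dist_lbound|exists w].
Qed.

Lemma le_dist z S (d : R) : S !=set0 ->
  (forall w, S w -> d <= cabs (z - w)) -> d <= dist z S.
Proof.
move=> [w0 Sw0] H; apply: lb_le_inf; first by exists (cabs (z - w0)), w0.
by move=> _ [w Sw <-]; exact: H.
Qed.

Lemma dist_triangle z w S : S !=set0 -> dist z S <= dist w S + cabs (z - w).
Proof.
move=> S0; rewrite -lerBlDr; apply: le_dist => // q Sq.
rewrite lerBlDr; apply: (le_trans (dist_le z Sq)).
have -> : z - q = (w - q) + (z - w) by ring.
exact: cabsD.
Qed.

Lemma dist_setU_le z S T : T !=set0 -> dist z (S `|` T) <= dist z T.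
Proof. by move=> T0; apply: le_dist => // w Tw; apply: dist_le; right. Qed.

Lemma dist_gt0 z S : closed S -> S !=set0 -> ~ S z -> 0 < dist z S.
Proof.
move=> cS S0 Sz; have oS : open (~` S) by exact: closed_openC.
have /nbhs_cabsP[d d0 Hd] : nbhs z (~` S) by exact: open_nbhs_nbhs.
apply: (lt_le_trans d0); apply: le_dist => // w Sw; rewrite leNgt; apply/negP.
by rewrite cabs_distC => /Hd; apply.
Qed.

Lemma bounded_dist_le (D S : set R[i]^o) : bounded_set D -> S !=set0 ->
  exists2 M : R, 0 < M & forall z, D z -> dist z S <= M.
Proof.
move=> bD [w0 Sw0]; have [M /= [Mr HM]] := bD.
have /complex_realP[m mE] := Mr.
pose m' : R := Num.max 0 m + 1.
have m'0 : 0 < m' by rewrite ltr_pwDr // le_max lexx.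
exists (m' + cabs w0); first by rewrite ltr_wpDr ?cabs_ge0.
move=> z Dz; apply: (le_trans (dist_le z Sw0)); apply: (le_trans (cabsB _ _)).
rewrite lerD2r -lecR -cabsE; apply: HM => //.
by rewrite mE ltcR /m' ltr_pwDr // le_max lexx orbT.
Qed.

(** One margin for all points of [K]: around each point half of its own radius works, and
    compactness makes the choice uniform. *)
Lemma compact_open_margin (K D : set R[i]^o) : compact K -> open D ->
  K `<=` D -> exists2 r : R, 0 < r &
    forall z, K z -> forall w, cabs (w - z) < r -> D w.
Proof.
move=> cK oD KD.
pose P (r : R) (z : R[i]^o) := forall w, cabs (w - z) < r -> D w.
have /compact_near_coveringP nK := cK.
have [|r /= r0 Hr] := nK R (0^'+) P _.
  move=> x Kx; have /nbhs_cabsP[d d0 Hd] : nbhs x D.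
    by apply: open_nbhs_nbhs; split => //; exact: KD.
  have d20 : 0 < d / 2 by rewrite divr_gt0.
  exists ([set z | cabs (z - x) < d / 2], [set r | r < d / 2]) => /=.
    by split; [apply/nbhs_cabsP; exists (d / 2)|exact: nbhs_right_lt].
  move=> [z r] [/= zx rd] w wz; apply: Hd.
  have -> : w - x = (w - z) + (z - x) by ring.
  apply: (le_lt_trans (cabsD _ _)); rewrite (splitr d) ltrD //.
  exact: lt_trans rd.
exists (r / 2); first by rewrite divr_gt0.
move=> z Kz; apply: (Hr (r / 2)) => //.
  by rewrite /ball /= sub0r normrN ger0_norm; lra.
by rewrite divr_gt0.
Qed.

End DistanceToSet.
Section CurveFrame.
Variable R : realType.
Implicit Types (a q e : R[i]^o) (A : set R[i]^o).

Lemma vec2E0 (x y : R) : vec2 x y 0 0 = x.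
Proof. by rewrite mxE. Qed.

Lemma vec2E1 (x y : R) : vec2 x y 1 0 = y.
Proof. by rewrite mxE. Qed.

(** An orthogonal matrix is a rotation up to a reflection: [e] is its first row read as a complex
    number, dividing by [e] is the rotation, and [s] is the determinant. *)
Lemma orthogonal_frame (U : 'M[R]_2) : U *m U^T = 1%:M ->
  exists (e : R[i]^o) (s : R), [/\ cabs e = 1, s ^+ 2 = 1 &
    forall a q, U *m (C_to_R2 q - C_to_R2 a)
      = vec2 (complex.Re ((q - a) / e)) (s * complex.Im ((q - a) / e))].
Proof.
move=> UU; pose u00 : R := U 0 0; pose u01 : R := U 0 1.
pose u10 : R := U 1 0; pose u11 : R := U 1 1.
have entry (i j : 'I_2) : U i 0 * U j 0 + U i 1 * U j 1 = (i == j)%:R.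
  have := congr1 (fun M : 'M[R]_2 => M i j) UU; rewrite !mxE => <-.
  rewrite big_ord_recl big_ord1 !mxE (_ : lift ord0 ord0 = 1) //.
  exact/val_inj.
have := entry 0 0; have := entry 1 1; have := entry 0 1.
rewrite /= -/u00 -/u01 -/u10 -/u11 => E01 E11 E00.
have n1 : u00 ^+ 2 + u01 ^+ 2 = 1 by rewrite !expr2.
pose s := u00 * u11 - u01 * u10.
have u10E : u10 = - (s * u01).
  transitivity (u10 * (u00 * u00 + u01 * u01)); first by rewrite E00 mulr1.
  transitivity (u00 * (u00 * u10 + u01 * u11) - s * u01); first by rewrite /s; ring.
  by rewrite E01 mulr0 sub0r.
have u11E : u11 = s * u00.
  transitivity (u11 * (u00 * u00 + u01 * u01)); first by rewrite E00 mulr1.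
  transitivity (u01 * (u00 * u10 + u01 * u11) + s * u00); first by rewrite /s; ring.
  by rewrite E01 mulr0 add0r.
exists (u00 +i* u01)%C, s; split.
- by rewrite /cabs /= n1 sqrtr1.
- transitivity (u10 * u10 + u11 * u11); last exact: E11.
  transitivity (s ^+ 2 * (u00 * u00 + u01 * u01)); first by rewrite E00 mulr1.
  by rewrite u10E u11E; ring.
move=> [ax ay] [qx qy]; apply/colP => i; rewrite mxE big_ord_recl big_ord1.
rewrite (_ : lift ord0 ord0 = 1); last exact/val_inj.
rewrite /C_to_R2 /= !mxE /= n1 !invr1 ?divr1.
have [->|i0] := eqVneq i 0; first by rewrite /= -/u00 -/u01; ring.
have -> : i = 1 by apply/val_inj; case: i i0 => -[|[|]].
by rewrite -/u10 -/u11 u10E u11E; ring.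
Qed.

(** Only one inclusion is kept: points of [A] in the box lie on the graph, while the graph may leave
    [A]. The constants L and r are common to all points. *)
Lemma curve_frame A (G : set 'cV[R]_2) : lipschitz_curve G ->
  [set C_to_R2 z | z in A] `<=` G ->
  exists L r : R, [/\ 0 < L, 0 < r & forall a, A a ->
    exists (e : R[i]^o) (phi : R -> R),
    [/\ cabs e = 1, phi 0 = 0,
      forall s t, `|s| < r -> `|t| < r -> `|phi s - phi t| <= L * `|s - t| &
      forall q, A q -> `|complex.Re ((q - a) / e)| < r ->
        `|complex.Im ((q - a) / e)| < 3 * L * r ->
        complex.Im ((q - a) / e) = phi (complex.Re ((q - a) / e))]].
Proof.
move=> [_ [L [r [L0 r0 HG]]]] AG; exists L, r; split => // a Aa.
have Ga : G (C_to_R2 a) by apply: AG; exists a.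
have [phi [U [lip UU box]]] := HG _ Ga.
have [e [s [e1 s1 frame]]] := orthogonal_frame UU.
have L3 : 0 < 3 * L * r by rewrite !mulr_gt0.
have sn : `|s| = 1.
  by apply/eqP; rewrite -(@eqrXn2 _ 2) // real_normK ?num_real // s1 expr1n.
have graph q : A q -> `|complex.Re ((q - a) / e)| < r ->
    `|complex.Im ((q - a) / e)| < 3 * L * r ->
    s * complex.Im ((q - a) / e) = phi (complex.Re ((q - a) / e)).
  move=> Aq hR hI; set x := complex.Re _; set y := complex.Im _.
  have : ([set vec2 x y | x in `]- r, r[ & y in `](- (3 * L * r)), (3 * L * r)[]
            `&` [set U *m (u - C_to_R2 a) | u in G]) (vec2 x (s * y)).
    split; last first.
      by exists (C_to_R2 q); [apply: AG; exists q|exact: frame].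
    exists x; first by rewrite /= in_itv /= -ltr_norml.
    exists (s * y) => //.
    by rewrite /= in_itv /= -ltr_norml normrM sn mul1r.
  rewrite box => -[x' _ E].
  have Ex : x' = x by rewrite -(vec2E0 x' (phi x')) E vec2E0.
  by rewrite -Ex -(vec2E1 x' (phi x')) E vec2E1.
(* The possible reflection is absorbed into the function, using s^2 = 1; it vanishes at 0 because
   [a] itself is the origin of its frame. *)
exists e, (fun t => s * phi t); split => //.
- have := graph a Aa; rewrite subrr mul0r /= normr0 mulr0 => /(_ r0 L3) <-.
  by rewrite mulr0.
- move=> t t' ht ht'; rewrite -mulrBr normrM sn mul1r.
  apply: (lip (t, t')); split => /=; by rewrite in_itv /= -ltr_norml.
- move=> q Aq hR hI; rewrite -graph // mulrA -expr2 s1 mul1r //.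
Qed.

End CurveFrame.
Section Localization.
Variable R : realType.
Implicit Types (z w a q : R[i]^o) (Omega B A : set R[i]^o).

(** For u on the graph the Lipschitz bound gives gap <= (1 + L) |s x - u|. For u outside the box the
    distance is large by itself, while the gap is at most 3 L s. *)
Lemma curve_distance (L r s : R) (phi : R -> R) (x u : R[i]^o) :
  0 < L -> 0 < s -> 2 * s <= r ->
  phi 0 = 0 ->
  (forall s t, `|s| < r -> `|t| < r -> `|phi s - phi t| <= L * `|s - t|) ->
  (`|complex.Re u| < r -> `|complex.Im u| < 3 * L * r ->
     complex.Im u = phi (complex.Re u)) ->
  in_rect (-1) 1 (- (2 * L)) (2 * L) x ->
  s * graph_gap (fun t => phi (s * t) / s) x / (3 * (1 + L))
    <= cabs (s%:C%C * x - u).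
Proof.
move=> L0 s0 sr phi0 lip hu /andP[hR hI].
have sE (y : R) : s * `|y| = `|s * y| by rewrite normrM (gtr0_norm s0).
have gE : s * graph_gap (fun t => phi (s * t) / s) x =
    `|s * complex.Im x - phi (s * complex.Re x)|.
  by rewrite /graph_gap sE mulrBr mulrCA mulfV ?gt_eqF // mulr1.
have K0 : 0 < 3 * (1 + L) by clear -L0; lra.
have hsR : `|s * complex.Re x| <= s.
  by rewrite normrM (gtr0_norm s0) ler_piMr ?(ltW s0) // ler_norml.
have hsRr : `|s * complex.Re x| < r by move: hsR sr s0; clear; lra.
have r0 : 0 < r by move: sr s0; clear; lra.
have hsI : `|s * complex.Im x| <= 2 * (L * s).
  rewrite normrM (gtr0_norm s0) (_ : 2 * (L * s) = s * (2 * L)); last by ring.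
  by rewrite ler_pM2l // ler_norml.
have Ls0 : 0 < L * s by rewrite mulr_gt0.
have g3 : `|s * complex.Im x - phi (s * complex.Re x)| <= 3 * (L * s).
  have h0 : `|0 : R| < r by rewrite normr0.
  have := lip _ 0 hsRr h0; rewrite phi0 !subr0 => hp.
  have : L * `|s * complex.Re x| <= L * s by rewrite ler_pM2l.
  have := ler_normB (s * complex.Im x) (phi (s * complex.Re x)).
  by move: hp hsI; clear; lra.
have hcR : `|s * complex.Re x - complex.Re u| <= cabs (s%:C%C * x - u).
  apply: le_trans (Re_le_cabs _); rewrite raddfB.
  by case: (x) => x1 x2 /=; rewrite mul0r subr0.
have hcI : `|s * complex.Im x - complex.Im u| <= cabs (s%:C%C * x - u).
  apply: le_trans (Im_le_cabs _); rewrite raddfB.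
  by case: (x) => x1 x2 /=; rewrite mul0r addr0.
rewrite gE ler_pdivrMr //.
have far (y : R) : y <= cabs (s%:C%C * x - u) -> 3 * (L * s) <= y * (3 * (1 + L)) ->
    `|s * complex.Im x - phi (s * complex.Re x)|
      <= cabs (s%:C%C * x - u) * (3 * (1 + L)).
  move=> hy hy3; apply: (le_trans g3); apply: (le_trans hy3).
  by rewrite ler_pM2r.
(* Outside the box horizontally the distance is at least r - s >= s; vertically it is at least 3 L r
   - 2 L s >= 4 L s. *)
have [ruR|ruR] := leP r `|complex.Re u|.
  apply: (far s).
    apply: le_trans hcR; have := lerB_dist (complex.Re u) (s * complex.Re x).
    by rewrite distrC; move: ruR hsR sr; clear; lra.
  by rewrite mulrDr mulrDr; move: Ls0 s0; rewrite (mulrC L); clear; lra.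
have [ruI|ruI] := leP (3 * L * r) `|complex.Im u|.
  apply: (far (4 * (L * s))).
    apply: le_trans hcI; have := lerB_dist (complex.Im u) (s * complex.Im x).
    have : L * (2 * s) <= L * r by rewrite ler_pM2l.
    by rewrite distrC; move: ruI hsI; rewrite -!mulrA; clear; lra.
  have : 0 <= L * s * L by rewrite mulr_ge0 // ltW.
  by move: Ls0; rewrite -!mulrA; clear; lra.
have {hu}hu := hu ruR ruI.
have := lip _ _ ruR hsRr; rewrite -hu => hl.
have : L * `|complex.Re u - s * complex.Re x| <= L * cabs (s%:C%C * x - u).
  by rewrite ler_pM2l // distrC.
have : `|s * complex.Im x - phi (s * complex.Re x)| <=
   `|s * complex.Im x - complex.Im u| + `|complex.Im u - phi (s * complex.Re x)|.
  by rewrite (le_trans _ (ler_normD _ _)) // addrA subrK.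
have c0 := cabs_ge0 (s%:C%C * x - u).
have Lc0 : 0 <= L * cabs (s%:C%C * x - u) by rewrite mulr_ge0 // ltW.
rewrite mulrCA mulrDr mulr1 (mulrC _ L).
by move: hl hcI c0 Lc0; clear; lra.
Qed.

(** The alternative depends on whether [z] is at distance at least kappa d from [A]: then the
    hypothesis on [f] can be used at [z] itself, otherwise in the frame of a nearby point of [A].
    Boundedness of [Omega] bounds d, so that rectangles of size c d fit the fixed box and margin. *)
Lemma localization Omega B A : open Omega -> bounded_set Omega ->
  closed B -> B !=set0 -> A `<=` Omega -> compact A ->
  (exists2 G, lipschitz_curve G & [set C_to_R2 z | z in A] `<=` G) ->
  exists L c kappa : R, [/\ 0 < L, 0 < c, 0 < kappa <= 1 &
    forall z, (Omega `\` B) z -> let d := dist z B in 0 < d /\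
      ((~ A z /\ kappa * d <= dist z (A `|` B)) \/
       exists (a k x : R[i]^o) (phi : R -> R),
       [/\ unit_graph L phi, z = a + k * x,
           `|complex.Re x| <= 1 / 2 /\ `|complex.Im x| <= L,
           forall w, in_rect (-1) 1 (- (2 * L)) (2 * L) w ->
             (Omega `\` B) (a + k * w) &
           forall w, in_rect (-1) 1 (- (2 * L)) (2 * L) w ->
             0 < graph_gap phi w -> ~ A (a + k * w) /\
             c * d * graph_gap phi w <= dist (a + k * w) (A `|` B) <= 2 * d])].
Proof.
move=> oO bO cB B0 AO cA [G GL AG].
have [L [r [L0 r0 HA]]] := curve_frame GL AG.
have [D D0 HD] := bounded_dist_le bO B0.
have [m m0 Hm] := compact_open_margin cA oO AO.
have l0 : 0 < 1 + 2 * L by clear -L0; lra.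
(* The three bounds keep the rectangle of scale c d away from [B], inside the frame box, and inside
   [Omega]. *)
pose c := Num.min (8 * (1 + 2 * L))^-1
  (Num.min (r / (2 * D)) (m / (2 * (1 + 2 * L) * D))).
have c0 : 0 < c.
  by rewrite /c !lt_min invr_gt0 !divr_gt0 // ?mulr_gt0.
have c1 : c * (1 + 2 * L) <= 1 / 8.
  rewrite -ler_pdivlMr // (_ : 1 / 8 / (1 + 2 * L) = (8 * (1 + 2 * L))^-1).
    by rewrite /c ge_min lexx.
  by rewrite invfM mul1r.
have c2 : c * (2 * D) <= r.
  by rewrite -ler_pdivlMr ?mulr_gt0 // /c !ge_min lexx orbT.
have c3 : c * (2 * (1 + 2 * L) * D) <= m.
  by rewrite -ler_pdivlMr ?mulr_gt0 // /c !ge_min lexx !orbT.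
have c8 : c <= 1 / 8.
  apply: le_trans c1; rewrite ler_peMr ?(ltW c0) //; clear -L0; lra.
(* |x| <= h places the rescaled point well inside the unit rectangle; hence kappa = c h. *)
pose h := Num.min (1 / 2) L; have h0 : 0 < h by rewrite /h lt_min L0 divr_gt0.
have h12 : h <= 1 / 2 by rewrite /h ge_min lexx.
have hL : h <= L by rewrite /h ge_min lexx orbT.
have K0 : 0 < 3 * (1 + L) by clear -L0; lra.
have ch : c * h <= 1 / 16.
  apply: (@le_trans _ _ (1 / 8 * (1 / 2))); last by clear; lra.
  by apply: ler_pM => //; exact: ltW.
exists L, (c / (3 * (1 + L))), (c * h); split => //.
- by rewrite divr_gt0.
- by rewrite mulr_gt0 //=; move: ch; clear; lra.
move=> z [Oz Bz] d; have d0 : 0 < d by exact: dist_gt0.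
split => //; have dD : d <= D by exact: HD.
have kd0 : 0 < c * h * d by rewrite !mulr_gt0.
have chd : c * h * d <= d / 16.
  by rewrite [leRHS]mulrC -[16^-1]mul1r ler_pM2r.
have [[a [Aa za]]|near] := pselect (exists a, A a /\ cabs (z - a) < c * h * d);
  last first.
  have far q : A q -> c * h * d <= cabs (z - q).
    by move=> Aq; rewrite leNgt; apply/negP => zq; apply: near; exists q.
  left; split.
    by move=> /far; rewrite subrr cabs0 leNgt kd0.
  apply: le_dist; first by case: B0 => b Bb; exists b; right.
  move=> w [/far//|Bw]; apply: le_trans (dist_le z Bw).
  by rewrite -/d; move: chd d0; clear; lra.
right; have [e [phi [e1 phi0 lip graph]]] := HA a Aa.
pose s := c * d; have s0 : 0 < s by rewrite mulr_gt0.
have sr : 2 * s <= r.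
  apply: le_trans c2; rewrite /s mulrCA ler_pM2l //.
  by rewrite ler_pM2l.
have sm : s * (1 + 2 * L) < m.
  have : s * (1 + 2 * L) <= c * D * (1 + 2 * L) by rewrite ler_pM2r // ler_pM2l.
  have -> : c * D * (1 + 2 * L) = c * (2 * (1 + 2 * L) * D) / 2 by field.
  by move: c3 m0; clear; lra.
have sd : s * (1 + 2 * L) <= d / 8.
  rewrite /s mulrAC [leRHS]mulrC -[8^-1]mul1r ler_pM2r //.
have sd8 : s <= d / 8.
  by rewrite /s [leRHS]mulrC -[8^-1]mul1r ler_pM2r.
have e0 : e != 0 by rewrite -cabs_gt0 e1.
have sC0 : (s%:C%C : R[i]) != 0 by rewrite -cabs_gt0 cabs_real gtr0_norm.
pose k : R[i]^o := e * s%:C%C.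
have ck : cabs k = s by rewrite cabsM e1 mul1r cabs_real gtr0_norm.
have k0 : k != 0 by rewrite mulf_neq0.
pose x : R[i]^o := (z - a) / k.
have cx : cabs x <= h.
  rewrite cabsM cabsV ck ler_pdivrMr // (le_trans (ltW za)) // /s.
  by rewrite mulrCA mulrA.
exists a, k, x, (fun t => phi (s * t) / s).
have inr t : -1 <= t <= 1 -> `|s * t| < r.
  rewrite -ler_norml normrM (gtr0_norm s0) => ht.
  apply: (@le_lt_trans _ _ s); first by rewrite ler_piMr // ltW.
  by move: sr s0; clear; lra.
have ug : unit_graph L (fun t => phi (s * t) / s).
  split; first by rewrite mulr0 phi0 mul0r.
  move=> t t' ht ht'; rewrite -mulrBl normrM normfV (gtr0_norm s0).
  rewrite ler_pdivrMr // (le_trans (lip _ _ (inr _ ht) (inr _ ht'))) //.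
  by rewrite -mulrBr normrM (gtr0_norm s0) mulrCA mulrC.
have cw w : in_rect (-1) 1 (- (2 * L)) (2 * L) w -> cabs (k * w) <= s * (1 + 2 * L).
  move=> /andP[]; rewrite -!ler_norml => hR hI; rewrite cabsM ck ler_pM2l //.
  by apply: (le_trans (cabs_le_ReIm _)); exact: lerD.
have zw w : in_rect (-1) 1 (- (2 * L)) (2 * L) w ->
    cabs (z - (a + k * w)) <= d / 4.
  move=> /cw hw; have -> : z - (a + k * w) = (z - a) - k * w by ring.
  by apply: (le_trans (cabsB _ _)); move: hw sd za chd d0; clear; lra.
have Bw w : in_rect (-1) 1 (- (2 * L)) (2 * L) w ->
    d / 2 <= dist (a + k * w) B.
  move=> /zw hw; have := dist_triangle z (a + k * w) B0.
  by rewrite -/d; move: hw d0; clear; lra.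
split.
- exact: ug.
- by rewrite /x mulrC divfK // addrC subrK.
- split; first by rewrite (le_trans (Re_le_cabs _)) // (le_trans cx).
  by rewrite (le_trans (Im_le_cabs _)) // (le_trans cx).
- move=> w Qw; split.
    apply: (Hm _ Aa); rewrite addrAC subrr add0r.
    exact: le_lt_trans (cw _ Qw) sm.
  move=> BB; have := Bw _ Qw; have := dist_le (a + k * w) BB.
  by rewrite subrr cabs0; move: d0; clear; lra.
- move=> w Qw gw; set g := graph_gap _ w in gw *.
  have Aw q : A q -> s * g / (3 * (1 + L)) <= cabs ((a + k * w) - q).
    move=> Aq; have := curve_distance L0 s0 sr phi0 lip (graph q Aq) Qw.
    rewrite -/g => /le_trans; apply; rewrite le_eqVlt; apply/orP; left.
    have -> : (a + k * w) - q = e * (s%:C%C * w - (q - a) / e).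
      by rewrite mulrBr [e * (_ / e)]mulrC divfK // /k; ring.
    by rewrite cabsM e1 mul1r.
  have sg0 : 0 < s * g / (3 * (1 + L)) by rewrite divr_gt0 // mulr_gt0.
  split; first by move=> /Aw; rewrite subrr cabs0 leNgt sg0.
  apply/andP; split.
    have -> : c / (3 * (1 + L)) * d * g = s * g / (3 * (1 + L)).
      by rewrite /s; field; rewrite gt_eqF //; clear -L0; lra.
    apply: le_dist; first by case: B0 => b Bb; exists b; right.
    (* Points of [B] are at distance at least d/2, more than enough since g <= 3 L and s <= d/8. *)
    move=> q [/Aw //|Bq]; apply: le_trans (dist_le (a + k * w) Bq).
    apply: le_trans (Bw _ Qw).
    have gL : g <= 3 * L by exact: graph_gap_le Qw.
    apply: (@le_trans _ _ s); last by move: sd8 d0; clear; lra.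
    rewrite ler_pdivrMr // ler_pM2l //; move: gL L0; clear; lra.
  apply: (le_trans (dist_setU_le _ _ B0)).
  have := dist_triangle (a + k * w) z B0; rewrite cabs_distC -/d.
  by have := zw _ Qw; move: d0; clear; lra.
Qed.

End Localization.

(** * Conclusion: undoing the rescaling in both cases *)

Theorem corollary2p8 (R : realType) (Omega B A : set R[i]^o)
    (f : R[i]^o -> R[i]^o)
    (Omega_domain : is_domain Omega) (Omega_bounded : bounded_set Omega)
    (B_closed : closed B) (B_nonempty : B !=set0)
    (A_Omega : A `<=` Omega) (A_compact : compact A)
    (A_curve : exists2 G, lipschitz_curve G & [set C_to_R2 z | z in A] `<=` G)
    (f_analytic : analytic_on (Omega `\` B) f) :
  (forall b C : R, 0 < b -> 0 < C ->
     (forall z, (Omega `\` (A `|` B)) z ->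
        cabs (f z) <= C * dist z (A `|` B) `^ (- b)) ->
     exists C1 : R, forall z, (Omega `\` B) z ->
        cabs (f z) <= C1 * dist z B `^ (- b))
  /\
  (forall a b alpha : R, 0 < a -> 0 < b -> 0 < alpha ->
     (forall z, (Omega `\` (A `|` B)) z -> dist z (A `|` B) < alpha ->
        cabs (f z) <= a * ln (1 / dist z (A `|` B)) `^ b) ->
     exists eps tau : R, 0 < tau < eps /\
       forall z, (Omega `\` B) z -> dist z B < tau ->
         cabs (f z) <= a * ln (eps / dist z B) `^ b).
Proof.
have [_ Omega_open _] := Omega_domain.
have [L [c [kappa [L0 c0 /andP[k0 k1] loc]]]] := localization Omega_open
  Omega_bounded B_closed B_nonempty A_Omega A_compact A_curve.
pose Q := in_rect (-1 : R) 1 (- (2 * L)) (2 * L).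
have dF (a k : R[i]^o) : (forall w, Q w -> (Omega `\` B) (a + k * w)) ->
    forall w, Q w -> derivable (fun w => f (a + k * w)) w 1.
  by move=> OB w Qw; apply: derivable_comp_affine; exact/f_analytic/OB.
have NAB z : ~ A z -> (Omega `\` B) z -> (Omega `\` (A `|` B)) z.
  by move=> Az [Oz Bz]; split => // -[].
split=> [b C b0 C0 fC|a b alpha a0 b0 alpha0 fab].
- have anti (x y : R) : 0 < x -> x <= y -> y `^ (- b) <= x `^ (- b).
    move=> x0 xy; have y0 : 0 < y by exact: lt_le_trans xy.
    rewrite !powRN lef_pV2 ?posrE ?powR_gt0 //.
    by apply: ge0_ler_powR => //; rewrite ?nnegrE ltW.
  (* [n.+1] is an integer at least b; the surplus exponent n + 1 - b is paid for by g <= 3 L, which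
     produces [M] below. *)
  pose n := Num.Def.trunc b.
  have bn : b <= n.+1%:R by case/andP: (truncn_itv (ltW b0)) => _ /ltW.
  have [K K0 HK] := power_bound n L0.
  have L3 : 0 < 3 * L by rewrite mulr_gt0.
  pose M : R := C * c `^ (- b) * (3 * L) `^ (n.+1%:R - b).
  have M0 : 0 <= M by rewrite !mulr_ge0 ?powR_ge0 ?ltW.
  exists (C * kappa `^ (- b) + K * M) => z OBz.
  have [d0 [[Az far]|[p [k [x [phi [ug zE [xR xI] OB near]]]]]]] := loc z OBz.
    apply: (le_trans (fC _ (NAB _ Az OBz))).
    rewrite mulrDl; apply: ler_wpDr.
      by rewrite mulr_ge0 ?powR_ge0 // mulr_ge0 // ltW.
    rewrite -mulrA ler_pM2l // -powRM ?(ltW k0) ?(ltW d0) //.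
    by apply: anti far; rewrite mulr_gt0.
  set d := dist z B in d0 near *; rewrite zE.
  apply: (@le_trans _ _ (K * (M * d `^ (- b)))); last first.
    by rewrite mulrA ler_wpM2r ?powR_ge0 // lerDr mulr_ge0 ?powR_ge0 // ltW.
  apply: (HK phi (fun w => f (p + k * w)) _ ug _ (dF _ _ OB) _ x xR xI).
    by rewrite mulr_ge0 ?powR_ge0.
  move=> w Qw g0; have [Aw /andP[gd _]] := near w Qw g0.
  set g := graph_gap phi w in g0 gd *.
  have cdg : 0 < c * d * g by rewrite !mulr_gt0.
  have gL : g <= 3 * L by exact: graph_gap_le Qw.
  have fw : cabs (f (p + k * w)) <= C * (c * d * g) `^ (- b).
    apply: (le_trans (fC _ (NAB _ Aw (OB _ Qw)))).
    by rewrite ler_pM2l //; exact: anti.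
  apply: (le_trans (ler_wpM2r (exprn_ge0 _ (ltW g0)) fw)).
  rewrite !powRM ?mulr_ge0 ?(ltW c0) ?(ltW d0) ?(ltW g0) //.
  have -> : C * (c `^ (- b) * d `^ (- b) * g `^ (- b)) * g ^+ n.+1 =
      C * c `^ (- b) * d `^ (- b) * (g `^ (- b) * g ^+ n.+1) by ring.
  rewrite -(powR_mulrn _ (ltW g0)) -powRD; last by rewrite (gt_eqF g0) implybT.
  rewrite /M [leRHS]mulrAC [- b + _]addrC; apply: ler_wpM2l.
    by rewrite !mulr_ge0 ?powR_ge0 ?ltW.
  by apply: ge0_ler_powR; rewrite ?subr_ge0 // ?nnegrE ltW.
- have [K K0 HK] := log_bound L0.
  (* Near [A], ln (eps1 / d) = -ln (c d) + K is the rescaled bound; far from [A], ln (eps2 / d) =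
     -ln (kappa d). The sum of the two dominates both. *)
  pose eps1 : R := expR K / c; pose eps2 : R := kappa^-1.
  have e10 : 0 < eps1 by rewrite divr_gt0 // expR_gt0.
  have e20 : 0 < eps2 by rewrite invr_gt0.
  pose Lam0 : R := 1 + `|ln (3 * L)|.
  (* The rectangle has distances to [A] and [B] at most 2 d: alpha/2 makes the hypothesis applicable
     there, 1/2 keeps the logarithms nonnegative. The third bound gives -ln (c d) >= Lam0, the last
     gives tau < eps. *)
  pose tau : R := Num.min (Num.min (alpha / 2) (1 / 2))
    (Num.min ((c * expR Lam0)^-1) (eps1 / 2)).
  have t0 : 0 < tau.
    have h1 : 0 < alpha / 2 by rewrite divr_gt0.
    have h2 : 0 < 1 / 2 :> R by rewrite divr_gt0.
    have h3 : 0 < (c * expR Lam0)^-1 by rewrite invr_gt0 mulr_gt0 // expR_gt0.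
    have h4 : 0 < eps1 / 2 by rewrite divr_gt0.
    by rewrite /tau !lt_min h1 h2 h3 h4.
  have t1 : 2 * tau <= alpha by rewrite mulrC -ler_pdivlMr // /tau !ge_min lexx.
  have t2 : 2 * tau <= 1 by rewrite mulrC -ler_pdivlMr // /tau !ge_min lexx orbT.
  have t3 : tau <= (c * expR Lam0)^-1 by rewrite /tau !ge_min lexx !orbT.
  have t4 : tau <= eps1 / 2 by rewrite /tau !ge_min lexx !orbT.
  exists (eps1 + eps2), tau; split.
    by rewrite t0 /=; move: t4 e10 e20; clear; lra.
  move=> z OBz dt; have [d0 alt] := loc z OBz; move: d0 alt dt.
  set d := dist z B => d0 alt dt.
  have mono (X Y : R) : 0 <= X -> X <= Y -> a * X `^ b <= a * Y `^ b.
    move=> X0 XY; rewrite ler_pM2l //; apply: ge0_ler_powR => //.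
    - exact: ltW.
    - by rewrite nnegrE (le_trans X0).
  have lnd (e : R) : 0 < e -> e <= eps1 + eps2 ->
      ln (e / d) <= ln ((eps1 + eps2) / d).
    move=> e0 ee; rewrite ler_ln ?posrE ?divr_gt0 ?addr_gt0 //.
    by rewrite ler_pM2r ?invr_gt0.
  case: alt => [[Az far]|[p [k [x [phi [ug zE [xR xI] OB near]]]]]].
    have kd0 : 0 < kappa * d by rewrite mulr_gt0.
    have dAB : dist z (A `|` B) <= d by exact: dist_setU_le.
    have dAB0 : 0 < dist z (A `|` B) by exact: lt_le_trans far.
    have dal : dist z (A `|` B) < alpha.
      by move: dAB dt t1 t0; clear; lra.
    apply: (le_trans (fab _ (NAB _ Az OBz) dal)); apply: mono.
      by rewrite ln_ge0 // ler_pdivlMr // mul1r; move: dAB dt t2 t0; clear; lra.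
    apply: (@le_trans _ _ (ln (eps2 / d))); last by apply: lnd; rewrite ?lerDr ?ltW.
    rewrite ler_ln ?posrE ?divr_gt0 // mul1r /eps2 -invfM.
    by rewrite lef_pV2 ?posrE.
  pose Lam : R := - ln (c * d).
  have cd0 : 0 < c * d by rewrite mulr_gt0.
  have Lam0L : Lam0 <= Lam.
    rewrite /Lam lerNr -[leRHS]expRK ler_ln ?posrE ?expR_gt0 // expRN.
    by have := le_trans (ltW dt) t3; rewrite invfM ler_pdivlMl.
  have Lam1 : 1 <= Lam by apply: le_trans Lam0L; rewrite lerDl.
  have Lam3 : 1 + ln (3 * L) <= Lam.
    by apply: le_trans Lam0L; rewrite lerD2l ler_norm.
  have step : cabs (f (p + k * x)) <= a * (Lam + K) `^ b.
    apply: (HK phi (fun w => f (p + k * w)) _ _ _ ug a0 b0 Lam1 Lam3 (dF _ _ OB) _ x xR xI).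
    move=> w Qw g0; have [Aw /andP[gd d2]] := near w Qw g0.
    set g := graph_gap phi w in g0 gd *.
    have cdg : 0 < c * d * g by rewrite !mulr_gt0.
    have dw0 := lt_le_trans cdg gd.
    have dal : dist (p + k * w) (A `|` B) < alpha.
      by apply: (le_lt_trans d2); move: dt t1; clear; lra.
    apply: (le_trans (fab _ (NAB _ Aw (OB _ Qw)) dal)); apply: mono.
      rewrite ln_ge0 // ler_pdivlMr // mul1r; apply: (le_trans d2).
      by move: dt t2; clear; lra.
    have -> : Lam - ln g = - ln (c * d * g).
      by rewrite /Lam [in RHS]lnM ?posrE // opprD.
    by rewrite mul1r lnV ?posrE // lerN2 ler_ln ?posrE.
  rewrite zE; apply: (le_trans step); apply: mono.
    by move: Lam1 K0; clear; lra.
  apply: (@le_trans _ _ (ln (eps1 / d))); last by apply: lnd; rewrite ?lerDl ?ltW.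
  rewrite /eps1 -mulrA -invfM lnM ?posrE ?expR_gt0 ?invr_gt0 // expRK.
  by rewrite lnV ?posrE // addrC.
Qed.
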